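(* For the class of finite simple undirected graphs in which every vertex has degree at most $3$, computing an $\alpha$-optimal linear arrangement is polynomial-time reducible to computing an $\alpha$-optimal linear reassembling: there is a polynomial-time algorithm which, given a graph $G$ of this class and access to a procedure returning, for any graph $H$ of this class, an $\alpha$-optimal linear reassembling of $H$, outputs an $\alpha$-optimal linear arrangement of $G$. In particular, if $\alpha$-optimal linear reassemblings of graphs of this class can be computed in polynomial time, so can $\alpha$-optimal linear arrangements.
   Context: Let $G=(V,E)$, $n=|V|$. For $X\subseteq V$, $\deg_G(X)$ is the number of edges with exactly one endpoint in $X$. A linear binary tree over $V$ is a collection $\mathcal{L}=\{\{v_j\}\mid 1\le j\le n\}\cup\{\{v_1,\dots,v_k\}\mid 2\le k\le n\}$ for some enumeration $v_1,\dots,v_n$ of $V$; $(G,\mathcal{L})$ is a linear reassembling of $G$, with $\alpha(G,\mathcal{L})=\max_{X\in\mathcal{L}}\deg_G(X)$; it is $\alpha$-optimal if this value is minimal among all linear reassemblings of $G$. A linear arrangement of $G$ is a bijection $\varphi:V\to\{1,\dots,n\}$ with $\alpha(G,\varphi)=\max_{1\le i\le n}\deg_G(\{v\mid\varphi(v)\le i\})$ (its cutwidth); it is $\alpha$-optimal (minimum-cutwidth) if this value is minimal among all linear arrangements of $G$. *)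

(* Defs.v *)
From mathcomp Require Import all_boot.

Set Implicit Arguments.
Unset Strict Implicit.
Unset Printing Implicit Defensive.

Record sgraph (V : finType) := SGraph {
  adj :> rel V;
  adj_sym : symmetric adj;
  adj_irr : irreflexive adj }.

Section Graphs.
Variable V : finType.
Implicit Types (G : sgraph V) (X : {set V}) (L : {set {set V}}).
Implicit Types (phi : V -> nat).

Definition edges G : {set {set V}} :=
  [set [set p.1; p.2] | p in [pred p : V * V | G p.1 p.2]].

Definition deg G X : nat := #|[set e in edges G | #|e :&: X| == 1]|.

Definition vdeg G (v : V) : nat := #|[set w | G v w]|.

Definition enumeration (s : seq V) : Prop := uniq s /\ (forall v, v \in s).

Definition linear_tree_of (s : seq V) : {set {set V}} :=
  [set [set v] | v in [set: V]]
  :|: [set [set v in take (val k) s] | k in [pred k : 'I_#|V|.+1 | 2 <= k]].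

Definition linear_tree L : Prop :=
  exists2 s, enumeration s & L = linear_tree_of s.

Definition alpha_tree G L : nat := \max_(X in L) deg G X.

Definition optimal_reassembling G L : Prop :=
  linear_tree L /\
  forall L', linear_tree L' -> alpha_tree G L <= alpha_tree G L'.

Definition arrangement phi : Prop :=
  injective phi /\ forall i, (exists v, phi v = i) <-> 1 <= i <= #|V|.

Definition alpha_arr G phi : nat :=
  \max_(1 <= i < #|V|.+1) deg G [set v | phi v <= i].

Definition optimal_arrangement G phi : Prop :=
  arrangement phi /\
  forall phi', arrangement phi' -> alpha_arr G phi <= alpha_arr G phi'.

End Graphs.

(** The machine model is the one-variable WHILE language over binary trees of
    N. D. Jones (Computability and Complexity from a Programming Perspective),
    written in point-free form: a program transforms one tree, and auxiliary
    variables are kept in the components of that tree.  With unit costs this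
    model has the same polynomial-time computable functions as Turing machines:
    trees are immutable, hence can be stored with sharing, and every operation
    below is then a constant number of pointer manipulations.  As sharing lets
    a program build a tree of exponential size in linear time, an oracle call
    is charged the full (unshared) sizes of the query and of the answer.  Final
    outputs need no such charge for the problems below: their solutions have
    polynomial size. *)

Inductive tree := Leaf | Node of tree & tree.

Fixpoint tsize (t : tree) : nat :=
  if t is Node l r then (tsize l + tsize r).+1 else 1.

Definition tfst (t : tree) : tree := if t is Node l _ then l else Leaf.
Definition tsnd (t : tree) : tree := if t is Node _ r then r else Leaf.

Inductive prog :=
  | PId
  | PLeaf
  | PNode of prog & prog
  | PFst
  | PSnd
  | PSeq of prog & prog
  | PIf of prog & prog & prog
  | PWhile of prog & prog
  | POracle.

(** [exec O p x y t]: with oracle [O], program [p] on input [x] halts with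
    output [y] after [t] steps.  A tree counts as true iff it is not [Leaf].
    A call outside the domain of [O] is stuck; programs without oracle are run
    with the empty oracle [no_oracle]. *)
Inductive exec (O : tree -> option tree) :
    prog -> tree -> tree -> nat -> Prop :=
  | ExId x : exec O PId x x 1
  | ExLeaf x : exec O PLeaf x Leaf 1
  | ExNode p q x y z t u :
      exec O p x y t -> exec O q x z u ->
      exec O (PNode p q) x (Node y z) (t + u).+1
  | ExFst x : exec O PFst x (tfst x) 1
  | ExSnd x : exec O PSnd x (tsnd x) 1
  | ExSeq p q x y z t u :
      exec O p x y t -> exec O q y z u ->
      exec O (PSeq p q) x z (t + u).+1
  | ExIfTrue b p q x l r y t u :
      exec O b x (Node l r) t -> exec O p x y u ->
      exec O (PIf b p q) x y (t + u).+1
  | ExIfFalse b p q x y t u :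
      exec O b x Leaf t -> exec O q x y u ->
      exec O (PIf b p q) x y (t + u).+1
  | ExWhileTrue b p x l r y z t u v :
      exec O b x (Node l r) t -> exec O p x y u ->
      exec O (PWhile b p) y z v ->
      exec O (PWhile b p) x z (t + u + v).+1
  | ExWhileFalse b p x t :
      exec O b x Leaf t -> exec O (PWhile b p) x x t.+1
  | ExOracle x y :
      O x = Some y -> exec O POracle x y (tsize x + tsize y).+1.

Definition no_oracle : tree -> option tree := fun=> None.

(** Execution is deterministic, so that [exists y t, exec O p x y t /\ _] below
    speaks about the unique run of [p] on [x]. *)
Lemma exec_det O p x y t y' t' :
  exec O p x y t -> exec O p x y' t' -> y = y' /\ t = t'.
Proof.
move=> e; elim: e y' t' => {x y t}; intros; subst;
  match goal with H : exec _ _ _ _ _ |- _ =>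
    inversion H; subst; clear H; try (by split) end;
  repeat match goal with
  | IH : forall y' t', exec _ ?p ?x _ _ -> _ /\ _, H : exec _ ?p ?x _ _ |- _ =>
      case: (IH _ _ H) => ? ?; clear IH; subst
  | H : Node _ _ = Node _ _ |- _ => case: H => ? ?; subst
  end; by [congruence | split; congruence].
Qed.

(** A search problem; solutions are given directly as output trees. *)
Record problem := Problem {
  instance : Type;
  encode : instance -> tree;
  solution : instance -> tree -> Prop }.

Definition solves_with (O : tree -> option tree) (p : prog) (P : problem)
    (c k : nat) : Prop :=
  forall i : instance P, exists y t,
    [/\ exec O p (encode i) y t,
        t <= c * tsize (encode i) ^ k
      & solution i y].

Definition oracle_for (Q : problem) (O : tree -> option tree) : Prop :=
  forall i : instance Q, exists2 y, O (encode i) = Some y & solution i y.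

(** The program and its time bound do not depend on the oracle. *)
Definition poly_reducible (P Q : problem) : Prop :=
  exists (p : prog) (c k : nat),
    forall O, oracle_for Q O -> solves_with O p P c k.

Definition poly_solvable (P : problem) : Prop :=
  exists (p : prog) (c k : nat), solves_with no_oracle p P c k.

(** As inputs of algorithms, graphs have vertex set [{0, ..., n-1}]. *)
Record subcubic := Subcubic {
  order : nat;
  graph :> sgraph 'I_order;
  subcubicP : forall v, vdeg graph v <= 3 }.

Definition enc_seq (A : Type) (enc : A -> tree) (s : seq A) : tree :=
  foldr (fun a t => Node (enc a) t) Leaf s.

Definition enc_bool (b : bool) : tree := if b then Node Leaf Leaf else Leaf.

(** Numbers are in unary; only numbers at most [n] are ever encoded. *)
Definition enc_nat (m : nat) : tree := enc_seq (fun=> Leaf) (iota 0 m).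

(** Sets of vertices are characteristic vectors, graphs adjacency matrices,
    arrangements the lists of their values. *)
Definition enc_set n (X : {set 'I_n}) : tree :=
  enc_seq (fun v => enc_bool (v \in X)) (enum 'I_n).

Definition enc_graph (G : subcubic) : tree :=
  enc_seq (fun v => enc_seq (fun w => enc_bool (G v w)) (enum 'I_(order G)))
          (enum 'I_(order G)).

Definition enc_arr n (phi : 'I_n -> nat) : tree :=
  enc_seq (fun v => enc_nat (phi v)) (enum 'I_n).

(** A collection of sets is written as a duplicate-free list of its members, in
    any order. *)
Definition represents n (y : tree) (L : {set {set 'I_n}}) : Prop :=
  exists s : seq {set 'I_n}, [/\ uniq s, s =i L & y = enc_seq (@enc_set n) s].

Definition reassembling_problem : problem :=
  Problem enc_graph (fun G y =>
    exists2 L, optimal_reassembling G L & represents y L).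

Definition arrangement_problem : problem :=
  Problem enc_graph (fun G y =>
    exists2 phi, optimal_arrangement G phi & y = enc_arr phi).

(* Main.v *)
(** A linear reassembling of [G] is an arrangement whose cost also counts the
    degrees of the singletons, so its value is [max(Delta, cutwidth)].  For
    degrees at most 3 the two optima thus coincide unless the cutwidth is at
    most 2.  Arrangements of cutwidth at most [k], for fixed [k], are found by a
    breadth-first search over partial arrangements, keeping one per directed cut
    [{(u, w) in E | u in X, w notin X}]: there are at most [(n^2 + 1)^k] such
    cuts, and two prefixes [X], [Y] with the same directed cut differ only by
    unions of components of [G], hence one can be completed iff the other can.
    The reduction tries [k = 0, 1, 2] and, if all fail, queries the oracle; the
    same search, now restricted to the members of the returned tree, turns the
    answer into an arrangement. *)

From mathcomp Require Import all_boot zify.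
Require Import Defs.

Set Implicit Arguments.
Unset Strict Implicit.
Unset Printing Implicit Defensive.

(** * Polynomial-time functions on trees *)

(** A time bound requires a size bound on every intermediate tree, so programs are obtained from a
    calculus of polynomial-time functions closed under composition and bounded iteration. Iterating
    the search step is polynomial only where the layers stay small, a combinatorial fact about
    genuine inputs; this is why bounds are relative to a domain [D] of trees. Partial arrangements
    carry the ranks of their vertices, so a state surviving to level [n] already is an encoded
    arrangement. In the oracle's answer, the chain that is found need not be the enumeration from
    which the tree was built: any chain of members growing by one vertex at a time up to the whole
    vertex set costs at most the value of the tree. Both claims of the theorem are instances of one
    statement about an arbitrary program [q] that solves the reassembling problem under some oracle:
    [q] is either the oracle call or the given polynomial-time program. *)

Lemma tsize_gt0 x : 0 < tsize x. Proof. by case: x. Qed.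

(** The base is at least 2, so a single exponent absorbs constants and coefficients. *)
Definition pbound (D : tree -> Prop) (F : tree -> nat) : Prop :=
  exists k, forall x, D x -> F x <= (tsize x).+1 ^ k.

Lemma pbound_le D F F' :
  (forall x, D x -> F x <= F' x) -> pbound D F' -> pbound D F.
Proof. by move=> le_F [k leF']; exists k => x Dx; apply: leq_trans (leF' x Dx); apply: le_F. Qed.

Lemma pbound_const D c : pbound D (fun=> c).
Proof.
exists c => x _; apply: leq_trans (ltnW (ltn_expl c (ltnSn 1))) _.
by case: c => // c; rewrite leq_exp2r // ltnS tsize_gt0.
Qed.

Lemma pbound_tsize D : pbound D tsize.
Proof. by exists 1 => x _; rewrite expn1. Qed.

Lemma pbound_mul D F F' :
  pbound D F -> pbound D F' -> pbound D (fun x => F x * F' x).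
Proof.
by move=> [k leF] [k' leF']; exists (k + k') => x Dx; rewrite expnD leq_mul ?leF ?leF'.
Qed.

Lemma pbound_add D F F' :
  pbound D F -> pbound D F' -> pbound D (fun x => F x + F' x).
Proof.
move=> bF bF'; apply: (@pbound_le _ _ (fun x => (F x).+1 * (F' x).+1)); first by move=> x _; nia.
have S F1 : pbound D F1 -> pbound D (fun x => (F1 x).+1).
  case=> k le; exists k.+1 => x Dx; rewrite expnS.
  have := le x Dx; have := tsize_gt0 x; have : 0 < (tsize x).+1 ^ k by rewrite expn_gt0.
  by nia.
by apply: pbound_mul; apply: S.
Qed.

Lemma pbound_exp D F k : pbound D F -> pbound D (fun x => F x ^ k).
Proof.
move=> [m leF]; exists (m * k) => x Dx; rewrite expnM.
by case: k => // k; rewrite leq_exp2r // leF.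
Qed.

(** [T] also bounds the output: sharing lets programs build trees of exponential
    size in linear time, so a time bound alone is not stable under composition. *)
Definition PTon (D : tree -> Prop) (f : tree -> tree) : Prop :=
  exists p T, pbound D T /\ forall O x, D x ->
    exists2 t, exec O p x (f x) t & t + tsize (f x) <= T x.

Notation PT := (PTon (fun=> True)).

Lemma PTon_tsize D f : PTon D f -> pbound D (fun x => tsize (f x)).
Proof.
case=> p [T [bT ex]]; apply: pbound_le bT => x Dx.
by have [t _] := ex no_oracle x Dx; apply: leq_trans; apply: leq_addl.
Qed.

Lemma PTon_sub D D' f : (forall x, D' x -> D x) -> PTon D f -> PTon D' f.
Proof.
move=> sub [p [T [[k bT] ex]]]; exists p, T; split=> [|O x /sub]; last exact: ex.
by exists k => x /sub; apply: bT.
Qed.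

Lemma PTW D f : PT f -> PTon D f.
Proof. exact: PTon_sub. Qed.

Lemma PTon_eq D f g : (forall x, D x -> f x = g x) -> PTon D f -> PTon D g.
Proof.
by move=> eq [p [T [bT ex]]]; exists p, T; split=> // O x Dx; rewrite -eq //; apply: ex.
Qed.

Lemma PTon_comp D D' g f :
  PTon D' g -> PTon D f -> (forall x, D x -> D' (f x)) -> PTon D (fun x => g (f x)).
Proof.
move=> [q [S [[k bS] eg]]] Pf sub; have bf := PTon_tsize Pf.
case: Pf => p [T [bT ef]].
exists (PSeq p q), (fun x => T x + ((tsize (f x) + 1) ^ k + 1)); split.
  by apply: pbound_add bT (pbound_add (pbound_exp _ (pbound_add bf _)) _); apply: pbound_const.
move=> O x Dx; have [t et let_] := ef O x Dx.
have [u eu leu] := eg O _ (sub _ Dx); exists (t + u).+1; first exact: ExSeq et eu.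
by have := bS _ (sub _ Dx); rewrite addn1; lia.
Qed.

Lemma PT_comp g f : PT g -> PT f -> PT (fun x => g (f x)).
Proof. by move=> Pg Pf; apply: PTon_comp Pg Pf _. Qed.

Lemma PT_prim p f : (forall O x, exec O p x (f x) 1) ->
  (forall x, tsize (f x) <= tsize x) -> PT f.
Proof.
move=> ex le; exists p, (fun x => 1 + tsize x); split.
  by apply: pbound_add; [apply: pbound_const | apply: pbound_tsize].
by move=> O x _; exists 1; rewrite // leq_add2l.
Qed.

Lemma PT_id : PT id.
Proof. by apply: (@PT_prim PId) => // O x; apply: ExId. Qed.

Lemma PT_leaf : PT (fun=> Leaf).
Proof. by apply: (@PT_prim PLeaf) => [O x|x]; [apply: ExLeaf | apply: tsize_gt0]. Qed.

Lemma PT_fst f : PT f -> PT (fun x => tfst (f x)).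
Proof.
apply: (@PT_comp tfst); apply: (@PT_prim PFst) => [O x|]; first exact: ExFst.
by case=> //= l r; lia.
Qed.

Lemma PT_snd f : PT f -> PT (fun x => tsnd (f x)).
Proof.
apply: (@PT_comp tsnd); apply: (@PT_prim PSnd) => [O x|]; first exact: ExSnd.
by case=> //= l r; lia.
Qed.

Lemma PT_node f g : PT f -> PT g -> PT (fun x => Node (f x) (g x)).
Proof.
move=> [p [T [bT ef]]] [q [S [bS eg]]].
exists (PNode p q), (fun x => T x + (S x + 2)); split.
  by apply: pbound_add bT (pbound_add bS _); apply: pbound_const.
move=> O x Dx; have [t et let_] := ef O x Dx; have [u eu leu] := eg O x Dx.
by exists (t + u).+1; [apply: ExNode | rewrite /=; lia].
Qed.

Definition truth (t : tree) : bool := if t is Node _ _ then true else false.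

Definition PTb (b : tree -> bool) : Prop := PT (fun x => enc_bool (b x)).

Lemma truth_enc_bool b : truth (enc_bool b) = b. Proof. by case: b. Qed.

Lemma PT_if_truth b f g :
  PT b -> PT f -> PT g -> PT (fun x => if truth (b x) then f x else g x).
Proof.
move=> [r [R [bR eb]]] [p [T [bT ef]]] [q [S [bS eg]]].
exists (PIf r p q), (fun x => R x + (T x + (S x + 1))); split.
  by apply: pbound_add bR (pbound_add bT (pbound_add bS _)); apply: pbound_const.
move=> O x Dx; have [t et let_] := ef O x Dx; have [u eu leu] := eg O x Dx.
have [v ev lev] := eb O x Dx.
case E: (b x) ev => [|l l'] ev /=.
  by exists (v + u).+1; [apply: ExIfFalse | lia].
by exists (v + t).+1; [apply: ExIfTrue ev et | lia].
Qed.

Lemma PT_if b f g :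
  PTb b -> PT f -> PT g -> PT (fun x => if b x then f x else g x).
Proof.
move=> Pb Pf Pg; apply: PTon_eq (PT_if_truth Pb Pf Pg) => x _.
by rewrite truth_enc_bool.
Qed.

Lemma PTb_const b : PTb (fun=> b).
Proof. by case: b; rewrite /PTb /=; [apply: PT_node|]; apply: PT_leaf. Qed.

Lemma PTb_truth f : PT f -> PTb (fun x => truth (f x)).
Proof.
move=> Pf; apply: PTon_eq (PT_if_truth Pf (PTb_const true) (PTb_const false)) => x _.
by case: (f x).
Qed.

Lemma PTb_if b c d : PTb b -> PTb c -> PTb d -> PTb (fun x => if b x then c x else d x).
Proof.
by move=> Pb Pc Pd; apply: PTon_eq (PT_if Pb Pc Pd) => x _; case: (b x).
Qed.

Lemma PTb_neg b : PTb b -> PTb (fun x => ~~ b x).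
Proof. by move=> Pb; apply: (PTb_if Pb (PTb_const false) (PTb_const true)). Qed.

Lemma PTb_and b c : PTb b -> PTb c -> PTb (fun x => b x && c x).
Proof. by move=> Pb Pc; apply: (PTb_if Pb Pc (PTb_const false)). Qed.

Lemma PTb_eq b c : PTb b -> PTb c -> PTb (fun x => b x == c x).
Proof.
move=> Pb Pc; apply: PTon_eq (PTb_if Pb Pc (PTb_neg Pc)) => x _.
by case: (b x); case: (c x).
Qed.

(** * Lists encoded as trees, and loops over them *)

Fixpoint lst (t : tree) : seq tree := if t is Node a t' then a :: lst t' else [::].
Definition trl (s : seq tree) : tree := foldr Node Leaf s.

Lemma lstK : cancel lst trl. Proof. by elim=> //= a _ t ->. Qed.
Lemma trlK : cancel trl lst. Proof. by elim=> //= a s ->. Qed.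

Lemma tsize_trl s : tsize (trl s) = (sumn (map tsize s) + size s).+1.
Proof. by elim: s => //= a s ->; lia. Qed.

Lemma size_le_tsize_trl s : size s <= tsize (trl s).
Proof. by rewrite tsize_trl; lia. Qed.

Definition PTs (l : tree -> seq tree) : Prop := PT (fun x => trl (l x)).

Lemma PTs_lst f : PT f -> PTs (fun x => lst (f x)).
Proof. by apply: PTon_eq => x _; rewrite lstK. Qed.

Lemma PTs_nil : PTs (fun=> [::]). Proof. exact: PT_leaf. Qed.

Lemma PTs_cons f l : PT f -> PTs l -> PTs (fun x => f x :: l x).
Proof. exact: PT_node. Qed.

Lemma PTs_behead l : PTs l -> PTs (fun x => behead (l x)).
Proof. by move/PT_snd; apply: PTon_eq => x _; case: (l x). Qed.

Lemma PTs_drop l k : PTs l -> PTs (fun x => drop k (l x)).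
Proof.
elim: k l => [|k IH] l Pl; first by apply: PTon_eq Pl => x _; rewrite drop0.
by apply: PTon_eq (IH _ (PTs_behead Pl)) => x _; case: (l x).
Qed.

(** The loop state is [Node l (Node z x)]: the list still to be read, the accumulator, the
    parameter. Since [Leaf] is both false and the empty list, [PFst] serves as the loop test. *)
Definition for_body (step : prog) : prog :=
  PNode (PSeq PFst PSnd)
        (PNode (PSeq (PNode (PSeq PFst PFst) PSnd) step) (PSeq PSnd PSnd)).

(** [M] need only bound the step at accumulators occurring in this very run, since the cost of a
    step depends on their size. Of the 20 extra units per round, 14 unpack and repack the state and
    2 pay for the test and the loop rule; the rest is slack. *)
Lemma exec_for O step (f : tree -> tree -> tree -> tree) x M s z :
  (forall s1 a s2, s = s1 ++ a :: s2 ->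
     let z1 := foldl (fun z a => f a z x) z s1 in
     exists2 t, exec O step (Node a (Node z1 x)) (f a z1 x) t & t <= M) ->
  exists2 t, exec O (PWhile PFst (for_body step)) (Node (trl s) (Node z x))
               (Node Leaf (Node (foldl (fun z a => f a z x) z s) x)) t
           & t <= size s * (M + 20) + 2.
Proof.
elim: s z => [|a s IH] z H.
  by exists 2 => //; apply: ExWhileFalse; apply: (@ExFst O (Node Leaf _)).
have [t et let_] := H [::] a s erefl.
have [|u eu leu] := IH (f a z x).
  by move=> s1 b s2 Es; apply: (H (a :: s1) b s2); rewrite Es.
have eb : exec O (for_body step) (Node (trl (a :: s)) (Node z x))
                 (Node (trl s) (Node (f a z x) x)) (t + 14).
  have -> : t + 14 = ((1 + 1).+1 + ((((1 + 1).+1 + 1).+1 + t).+1 + (1 + 1).+1).+1).+1.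
    by lia.
  have e1 p y : exec O PFst (Node p y) p 1 := @ExFst O (Node p y).
  have e2 p y : exec O PSnd (Node p y) y 1 := @ExSnd O (Node p y).
  by repeat (eapply ExNode || eapply ExSeq || apply: e1 || apply: e2 || apply: et).
exists (1 + (t + 14) + u).+1; last by rewrite /= mulSn; lia.
by apply: ExWhileTrue eb eu; apply: (@ExFst O (Node (Node a (trl s)) _)).
Qed.

Lemma all_tsize_trl s : all (fun a => tsize a <= tsize (trl s)) s.
Proof.
elim: s => //= a s IH; rewrite leqW ?leq_addr //=.
by apply: sub_all IH => b leb; apply: leqW; apply: leq_trans leb (leq_addl _ _).
Qed.

(** The bound on all intermediate accumulators is left to the caller, for whom it may rest on
    properties of the inputs in [D]. *)
Lemma PTon_fold D step l z0 B :
  PT (fun y => step (tfst y) (tfst (tsnd y)) (tsnd (tsnd y))) ->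
  PTs l -> PT z0 -> pbound D B ->
  (forall x i, D x ->
     tsize (foldl (fun z a => step a z x) (z0 x) (take i (l x))) <= B x) ->
  PTon D (fun x => foldl (fun z a => step a z x) (z0 x) (l x)).
Proof.
move=> [ps [Ts [[k bTs] es]]] Pl Pz bB leB.
have [p [T [bT ep]]] : PTon D (fun x => Node (trl (l x)) (Node (z0 x) x)).
  by apply: PTW; apply: PT_node Pl (PT_node Pz PT_id).
(* Bounds the cost of one step, run on [Node a (Node z x)]: the 3 covers the two nodes and the
   successor in the base of [pbound]. *)
pose S x := (tsize (trl (l x)) + (B x + (tsize x + 3))) ^ k.
exists (PSeq p (PSeq (PWhile PFst (for_body ps)) (PSeq PSnd PFst))).
exists (fun x => T x + (tsize (trl (l x)) * (S x + 20) + (B x + 10))); split.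
  have bl : pbound D (fun x => tsize (trl (l x))) := PTon_tsize (PTW D Pl).
  have bS : pbound D S.
    apply: pbound_exp; apply: pbound_add bl (pbound_add bB (pbound_add _ _)).
      exact: pbound_tsize.
    exact: pbound_const.
  apply: pbound_add bT (pbound_add (pbound_mul bl (pbound_add bS _)) (pbound_add bB _));
    exact: pbound_const.
move=> O x Dx; have [t et let_] := ep O x Dx.
have [|u eu leu] := @exec_for O ps step x (S x) (l x) (z0 x).
  move=> s1 a s2 El z1.
  have lez1 : tsize z1 <= B x.
    by have := leB x (size s1) Dx; rewrite El take_size_cat.
  have [v ev lev] := es O (Node a (Node z1 x)) I.
  exists v => //; apply: leq_trans (leq_addr _ _) (leq_trans lev (leq_trans (bTs _ I) _)).
  have lea : tsize a <= tsize (trl (l x)).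
    by rewrite tsize_trl El map_cat sumn_cat /=; lia.
  by rewrite /S; case: k {bTs S} => // k; rewrite leq_exp2r //=; lia.
exists (t + (u + (1 + 1).+1).+1).+1.
  apply: ExSeq et (ExSeq eu (ExSeq _ _)); first exact: (@ExSnd O (Node _ _)).
  exact: (@ExFst O (Node _ _)).
have := leB x (size (l x)) Dx; rewrite take_size.
have : size (l x) * (S x + 20) <= tsize (trl (l x)) * (S x + 20).
  by rewrite leq_mul2r size_le_tsize_trl orbT.
by lia.
Qed.

(** Each step adds an amount independent of the state, which prevents the
    exponential growth that iterating a polynomial-time step can cause. *)
Lemma PT_fold step l z0 B :
  PT (fun y => step (tfst y) (tfst (tsnd y)) (tsnd (tsnd y))) ->
  PTs l -> PT z0 -> pbound (fun=> True) B ->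
  (forall a z x, tsize (step a z x) <= tsize z + B (Node a x)) ->
  PT (fun x => foldl (fun z a => step a z x) (z0 x) (l x)).
Proof.
move=> Ps Pl Pz [k bB] leB.
pose S x := (tsize (trl (l x)) + (tsize x + 2)) ^ k.
apply: (@PTon_fold _ _ _ _ (fun x => tsize (z0 x) + tsize (trl (l x)) * S x)) => //.
  have bl := PTon_tsize Pl.
  apply: pbound_add (PTon_tsize Pz) (pbound_mul bl (pbound_exp _ (pbound_add bl _))).
  by apply: pbound_add; [apply: pbound_tsize | apply: pbound_const].
move=> x i _; set s := take i _.
have : size s <= tsize (trl (l x)).
  by apply: leq_trans (size_le_tsize_trl _); rewrite size_take_min geq_minr.
have : all (fun a => tsize a <= tsize (trl (l x))) s.
  by have := all_tsize_trl (l x); rewrite -{2}(cat_take_drop i (l x)) all_cat => /andP[].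
rewrite {}/S; move: (tsize (trl (l x))) => N les leN; pose S := (N + (tsize x + 2)) ^ k.
have : tsize (foldl (fun z a => step a z x) (z0 x) s) <= tsize (z0 x) + size s * S.
  elim: s (z0 x) les {leN} => [|a s IH] z /=; first by rewrite addn0.
  case/andP=> lea les; apply: leq_trans (IH _ les) _.
  have := leB a z x; have : B (Node a x) <= S.
    by apply: leq_trans (bB _ I) _; rewrite /S; case: (k) => // m; rewrite leq_exp2r //=; lia.
  by rewrite mulSn; lia.
by move/leq_trans; apply; rewrite leq_add2l leq_mul2r leN orbT.
Qed.

Lemma foldl_cons_trl T f (s : seq T) t0 :
  foldl (fun z a => Node (f a) z) (trl t0) s = trl (catrev (map f s) t0).
Proof. by elim: s t0 => //= a s IH t0; rewrite -(IH (f a :: t0)). Qed.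

(** A left fold builds its list in reverse order; map, filter and zip below are corrected by one
    more reversal. *)
Lemma PTs_rev l : PTs l -> PTs (fun x => rev (l x)).
Proof.
move=> Pl.
have := @PT_fold (fun a z _ => Node a z) l (fun=> Leaf) (fun y => tsize y).
move=> /(_ (PT_node (PT_fst PT_id) (PT_fst (PT_snd PT_id))) Pl PT_leaf (pbound_tsize _)).
move=> H; apply: PTon_eq (H _) => [x _|a z x /=]; last by lia.
by rewrite -[Leaf]/(trl [::]) (foldl_cons_trl id) map_id.
Qed.

Lemma PTs_map g l :
  PT (fun y => g (tfst y) (tsnd y)) -> PTs l -> PTs (fun x => [seq g a x | a <- l x]).
Proof.
move=> Pg Pl.
have := @PT_fold (fun a z x => Node (g a x) z) l (fun=> Leaf)
   (fun y => tsize (g (tfst y) (tsnd y)) + 1).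
move=> H; have {}H := H _ Pl PT_leaf (pbound_add (PTon_tsize Pg) (pbound_const _ _)).
have PrevM : PTs (fun x => rev [seq g a x | a <- l x]).
  apply: PTon_eq (H _ _) => [x _||a z x /=]; last by lia.
    by rewrite -[Leaf]/(trl [::]) foldl_cons_trl.
  apply: PT_node (PT_fst (PT_snd PT_id)).
  exact: (PT_comp Pg (PT_node (PT_fst PT_id) (PT_snd (PT_snd PT_id)))).
by apply: PTon_eq (PTs_rev PrevM) => x _; rewrite revK.
Qed.

Lemma PTs_filter p l :
  PTb (fun y => p (tfst y) (tsnd y)) -> PTs l -> PTs (fun x => [seq a <- l x | p a x]).
Proof.
move=> Pp Pl.
have := @PT_fold (fun a z x => if p a x then Node a z else z) l (fun=> Leaf) (fun y => tsize y).
move=> H; have {}H := H _ Pl PT_leaf (pbound_tsize _).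
have PrevM : PTs (fun x => rev [seq a <- l x | p a x]).
  apply: PTon_eq (H _ _) => [x _||a z x /=]; last by case: ifP => /=; lia.
    rewrite -[Leaf]/(trl [::]) /rev; elim: (l x) [::] => //= a s IH t0.
    by case: ifP => _; rewrite -IH.
  apply: PT_if; last exact: (PT_fst (PT_snd PT_id)).
    exact: (PT_comp Pp (PT_node (PT_fst PT_id) (PT_snd (PT_snd PT_id)))).
  by apply: PT_node (PT_fst (PT_snd PT_id)); apply: PT_fst PT_id.
by apply: PTon_eq (PTs_rev PrevM) => x _; rewrite revK.
Qed.

Lemma PTb_has p l :
  PTb (fun y => p (tfst y) (tsnd y)) -> PTs l -> PTb (fun x => has (fun a => p a x) (l x)).
Proof.
move=> Pp Pl; apply: PTon_eq (PTb_truth (PTs_filter Pp Pl)) => x _.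
by congr enc_bool; elim: (l x) => //= a s IH; case: ifP.
Qed.

Lemma PTb_all p l :
  PTb (fun y => p (tfst y) (tsnd y)) -> PTs l -> PTb (fun x => all (fun a => p a x) (l x)).
Proof.
move=> Pp Pl; apply: PTon_eq (PTb_neg (@PTb_has (fun a x => ~~ p a x) l (PTb_neg Pp) Pl)) => x _.
by rewrite -[X in ~~ X]/(has (predC (fun a => p a x)) (l x)) has_predC negbK.
Qed.

Lemma PTs_cat l l' : PTs l -> PTs l' -> PTs (fun x => l x ++ l' x).
Proof.
move=> Pl Pl'.
have := @PT_fold (fun a z _ => Node a z) (fun x => rev (l x)) (fun x => trl (l' x))
  (fun y => tsize y).
move=> /(_ (PT_node (PT_fst PT_id) (PT_fst (PT_snd PT_id))) (PTs_rev Pl) Pl' (pbound_tsize _)).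
move=> H; apply: PTon_eq (H _) => [x _|a z x /=]; last by lia.
by rewrite (foldl_cons_trl id) map_id catrevE revK.
Qed.

Lemma PTs_flatten (l : tree -> seq tree) : PTs l -> PTs (fun x => flatten [seq lst a | a <- l x]).
Proof.
move=> Pl.
have := @PT_fold (fun a z _ => trl (lst a ++ lst z)) (fun x => rev (l x)) (fun=> Leaf)
  (fun y => tsize y).
move=> H; have {}H := H _ (PTs_rev Pl) PT_leaf (pbound_tsize _).
apply: PTon_eq (H _ _) => [x _||a z x /=].
- rewrite -[Leaf]/(trl [::]) foldl_rev.
  by elim: (l x) => //= a s ->; rewrite trlK.
- by apply: PTs_cat; apply: PTs_lst; [apply: PT_fst PT_id | apply: PT_fst (PT_snd PT_id)].
have := tsize_trl (lst a ++ lst z); have := tsize_trl (lst a); have := tsize_trl (lst z).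
by rewrite !lstK map_cat sumn_cat size_cat; lia.
Qed.

Fixpoint tzip (s t : seq tree) : seq tree :=
  if s is a :: s' then Node a (head Leaf t) :: tzip s' (behead t) else [::].

Lemma PTs_zip l l' : PTs l -> PTs l' -> PTs (fun x => tzip (l x) (l' x)).
Proof.
move=> Pl Pl'.
(* The accumulator pairs what remains of the second list with the reversed output. *)
pose f (a z : tree) := Node (tsnd (tfst z)) (Node (Node a (tfst (tfst z))) (tsnd z)).
have := @PT_fold (fun a z _ => f a z) l (fun x => Node (trl (l' x)) Leaf) (fun y => tsize y + 4).
move=> H; have {}H := H _ Pl (PT_node Pl' PT_leaf) (pbound_add (pbound_tsize _) (pbound_const _ _)).
have Prev : PTs (fun x => rev (tzip (l x) (l' x))).
  apply: PTon_eq (PT_snd (H _ _)) => [x _||a z x].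
  - rewrite -[Leaf]/(trl [::]) /rev; elim: (l x) (l' x) [::] => //= a s IH t t0.
    by rewrite -(IH _ (Node _ _ :: t0)); case: t.
  - have Pz := PT_fst (PT_snd PT_id).
    apply: PT_node (PT_snd (PT_fst Pz)) (PT_node (PT_node (PT_fst PT_id) _) (PT_snd Pz)).
    exact: PT_fst (PT_fst Pz).
  by rewrite /f; case: z => [|[|u v] w] /=; lia.
by apply: PTon_eq (PTs_rev Prev) => x _; rewrite revK.
Qed.

Lemma PTs_dropby l l' : PTs l -> PTs l' -> PTs (fun x => drop (size (l x)) (l' x)).
Proof.
move=> Pl Pl'.
have := @PT_fold (fun _ z _ => tsnd z) l (fun x => trl (l' x)) (fun=> 0).
move=> /(_ (PT_snd (PT_fst (PT_snd PT_id))) Pl Pl' (pbound_const _ _)) H.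
apply: PTon_eq (H _) => [x _|_ [|u v] _ /=]; [|by []|by lia].
elim: (l x) (l' x) => [|a s IH] [|b t] //=.
  by rewrite (IH [::]).
Qed.

Lemma PTb_eqsize l l' : PTs l -> PTs l' -> PTb (fun x => size (l x) == size (l' x)).
Proof.
move=> Pl Pl'.
have := PTb_and (PTb_neg (PTb_truth (PTs_dropby Pl Pl'))) (PTb_neg (PTb_truth (PTs_dropby Pl' Pl))).
apply: PTon_eq => x _; congr enc_bool.
have truth_drop (s t : seq tree) : truth (trl (drop (size s) t)) = (size s < size t).
  by rewrite -subn_gt0 -size_drop; case: drop.
by rewrite !truth_drop -!leqNgt andbC -eqn_leq.
Qed.

Lemma PTb_count p l k :
  PTb p -> PTs l -> PTb (fun x => count p (l x) <= k).
Proof.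
move=> Pp Pl; have Pf := @PTs_filter (fun a _ => p a) l (PT_comp Pp (PT_fst PT_id)) Pl.
apply: PTon_eq (PTb_neg (PTb_truth (PTs_drop k Pf))) => x _.
by rewrite leqNgt -size_filter -subn_gt0 -size_drop; case: drop.
Qed.

(** * Layered search *)

Definition tails (s : seq tree) : seq tree :=
  [seq trl (drop i s) | i <- iota 0 (size s)].

Lemma PTs_tails l : PTs l -> PTs (fun x => tails (l x)).
Proof.
move=> Pl.
(* The accumulator pairs a unary counter with the reversed list of tails. Each tail is recomputed
   from [l x] rather than from its predecessor, so that the growth per step is bounded independently
   of the state, as [PT_fold] requires. *)
pose f (a z x : tree) := Node (Node Leaf (tfst z))
   (Node (trl (drop (size (lst (tfst z))) (l x))) (tsnd z)).
have := @PT_fold f l (fun=> Node Leaf Leaf) (fun y => tsize (trl (l (tsnd y))) + 5).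
have Pl2 : PTs (fun y => l (tsnd y)) := PT_comp Pl (PT_snd PT_id).
move=> H; have {}H := H _ Pl (PT_node PT_leaf PT_leaf)
  (pbound_add (PTon_tsize Pl2) (pbound_const _ _)).
have Prev : PTs (fun x => rev (tails (l x))).
  apply: PTon_eq (PT_snd (H _ _)) => [x _||a z x].
  - rewrite /tails; set s := l x; rewrite -[X in Node X _]/(trl (nseq 0 Leaf)).
    rewrite -[X in Node _ X]/(trl [::]) /rev.
    have -> : forall r m t0, foldl (fun z a => f a z x) (Node (trl (nseq m Leaf)) (trl t0)) r
       = Node (trl (nseq (m + size r) Leaf))
           (trl (catrev [seq trl (drop i s) | i <- iota m (size r)] t0)).
      elim=> [|a r IH] m t0; first by rewrite addn0.
      rewrite /= addnS -addSn -(IH m.+1 (trl (drop m s) :: t0)) /f /=.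
      by rewrite trlK size_nseq.
    by [].
  - have Pz := PT_fst (PT_snd PT_id).
    apply: PT_node (PT_node PT_leaf (PT_fst Pz)) (PT_node _ (PT_snd Pz)).
    apply: PTs_dropby (PTs_lst (PT_fst Pz)) _.
    exact: (PT_comp Pl (PT_snd (PT_snd PT_id))).
  have le_drop i s : tsize (trl (drop i s)) <= tsize (trl s).
    by elim: s i => [|b s IH] [|i] //=; apply: leqW; apply: leq_trans (IH i) (leq_addl _ _).
  by have := le_drop (size (lst (tfst z))) (l x); rewrite /f; case: z => [|u v] /=; lia.
by apply: PTon_eq (PTs_rev Prev) => x _; rewrite revK.
Qed.

(** All ways to write [c] at one free (i.e. [Leaf]) position of [s]; a position
    is identified by the length of the tail starting there. *)
Definition exts (c : tree) (s : seq tree) : seq tree :=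
  [seq trl [seq if size (lst u) == size (lst t) then c else tfst u | u <- tails s]
     | t <- tails s & ~~ truth (tfst t)].

Lemma PTs_exts c l : PT c -> PTs l -> PTs (fun x => exts (c x) (l x)).
Proof.
move=> Pc Pl; have Pt := PTs_tails Pl.
apply: (@PTs_map (fun t x =>
   trl [seq if size (lst u) == size (lst t) then c x else tfst u | u <- tails (l x)])).
  apply: (@PTs_map (fun u y =>
    if size (lst u) == size (lst (tfst y)) then c (tsnd y) else tfst u)).
    apply: PT_if; last exact: PT_fst (PT_fst PT_id).
      by apply: PTb_eqsize; apply: PTs_lst; [apply: PT_fst PT_id | apply: PT_fst (PT_snd PT_id)].
    exact: PT_comp Pc (PT_snd (PT_snd PT_id)).
  exact: (PT_comp Pt (PT_snd PT_id)).
apply: (@PTs_filter (fun t _ => ~~ truth (tfst t))) => //.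
exact: PTb_neg (PTb_truth (PT_fst (PT_fst PT_id))).
Qed.

Definition dedup T (r : T -> T -> bool) (s : seq T) : seq T :=
  foldl (fun z a => if has (r a) z then z else a :: z) [::] s.

Lemma dedup_rcons T (r : T -> T -> bool) s a :
  dedup r (rcons s a) =
  if has (r a) (dedup r s) then dedup r s else a :: dedup r s.
Proof. by rewrite /dedup foldl_rcons. Qed.

(** This bounds the number of survivors; [mem_dedup] is its counterpart for completeness, providing
    each discarded element with a survivor in its place. *)
Lemma pairwise_dedup T (r : T -> T -> bool) s :
  pairwise (fun a b => ~~ r a b) (dedup r s).
Proof.
elim/last_ind: s => // s a IH; rewrite dedup_rcons; case: ifPn => //= nh.
by rewrite IH all_predC nh.
Qed.

Lemma dedup_map T U (f : T -> U) (r : U -> U -> bool) s :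
  dedup r (map f s) = map f (dedup (fun a b => r (f a) (f b)) s).
Proof.
elim/last_ind: s => // s a IH; rewrite map_rcons !dedup_rcons IH has_map.
by rewrite (@eq_has _ _ (fun b => r (f a) (f b))) //; case: ifP.
Qed.

Lemma eq_dedup T (r r' : T -> T -> bool) : r =2 r' -> dedup r =1 dedup r'.
Proof.
move=> eqr; elim/last_ind=> // s a IH; rewrite !dedup_rcons IH.
by rewrite (eq_has (eqr a)).
Qed.

Lemma dedup_sub (T : eqType) (r : T -> T -> bool) s : {subset dedup r s <= s}.
Proof.
elim/last_ind: s => // s a IH b; rewrite dedup_rcons mem_rcons in_cons.
by case: ifP => _; [|rewrite in_cons; case: eqP => //= _]; move/IH=> ->; rewrite ?orbT.
Qed.

Lemma mem_dedup (T : eqType) (r : T -> T -> bool) s a :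
  a \in s -> (a \in dedup r s) || has (r a) (dedup r s).
Proof.
elim/last_ind: s => // s b IH; rewrite mem_rcons in_cons dedup_rcons.
case/predU1P=> [->|/IH IHa].
  by case: ifPn => [->|_]; rewrite ?orbT ?mem_head.
by case: ifPn => // _; rewrite in_cons /=; case/orP: IHa => ->; rewrite !orbT.
Qed.

Lemma PTs_dedup r l :
  PTb (fun y => r (tfst y) (tfst (tsnd y)) (tsnd (tsnd y))) -> PTs l ->
  PTs (fun x => dedup (fun a b => r a b x) (l x)).
Proof.
move=> Pr Pl.
pose f (a z x : tree) := if has (fun b => r a b x) (lst z) then z else Node a z.
have := @PT_fold f l (fun=> Leaf) (fun y => tsize y).
move=> H; have {}H := H _ Pl PT_leaf (pbound_tsize _).
apply: PTon_eq (H _ _) => [x _||a z x]; last by rewrite /f; case: ifP => /=; lia.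
  rewrite /dedup -[Leaf]/(trl [::]); elim: (l x) [::] => //= a s IH t.
  by rewrite /f trlK; case: ifP => _; rewrite -IH.
have Pa := PT_fst PT_id; have Pz := PT_fst (PT_snd PT_id).
apply: PT_if => //; last exact: PT_node.
apply: (@PTb_has (fun b y => r (tfst y) b (tsnd (tsnd y)))); last exact: PTs_lst.
have Py := PT_snd PT_id.
exact: (PT_comp Pr (PT_node (PT_fst Py) (PT_node (PT_fst PT_id) (PT_snd (PT_snd Py))))).
Qed.

Section Search.
Variables (acc : tree -> tree -> bool) (sim : tree -> tree -> tree -> bool).
Variable clk : tree -> seq tree.

Definition next x (c : tree) (layer : seq tree) : seq tree :=
  dedup (fun s t => sim s t x)
    [seq t <- flatten [seq exts c (lst s) | s <- layer] | acc t x].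

(** The state pairs a unary counter with the current layer. The incremented counter is the value
    written, hence the rank of the vertex being placed. *)
Definition search_step (z x : tree) : tree :=
  Node (Node Leaf (tfst z)) (trl (next x (Node Leaf (tfst z)) (lst (tsnd z)))).

Definition search_start x : tree :=
  Node Leaf (trl [:: trl [seq Leaf | _ <- clk x]]).

(** Only the length of [clk x] matters: it is the number of rounds, and also the number of free
    positions at the start. *)
Definition search x : seq tree :=
  lst (tsnd (foldl (fun z _ => search_step z x) (search_start x) (clk x))).

Hypothesis Pacc : PTb (fun y => acc (tfst y) (tsnd y)).
Hypothesis Psim : PTb (fun y => sim (tfst y) (tfst (tsnd y)) (tsnd (tsnd y))).
Hypothesis Pclk : PTs clk.

Lemma PT_search_step z e : PT z -> PT e -> PT (fun x => search_step (z x) (e x)).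
Proof.
move=> Pz Pe; have Pc := PT_node PT_leaf (PT_fst Pz); apply: PT_node (Pc) _.
pose nx y := trl (next (tsnd (tsnd y)) (tfst y) (lst (tfst (tsnd y)))).
suff Pn : PT nx by apply: (PT_comp Pn (PT_node Pc (PT_node (PT_snd Pz) Pe))).
apply: (@PTs_dedup (fun a b y => sim a b (tsnd (tsnd y)))).
  have Py := PT_snd PT_id.
  exact: (PT_comp Psim (PT_node (PT_fst PT_id)
    (PT_node (PT_fst Py) (PT_snd (PT_snd (PT_snd Py)))))).
apply: (@PTs_filter (fun t y => acc t (tsnd (tsnd y)))).
  exact: (PT_comp Pacc (PT_node (PT_fst PT_id) (PT_snd (PT_snd (PT_snd PT_id))))).
apply: (@PTon_eq _ (fun y => trl (flatten [seq lst a | a <-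
   [seq trl (exts (tfst y) (lst s)) | s <- lst (tfst (tsnd y))]]))) => [y _|].
  by rewrite -map_comp; congr (trl (flatten _)); apply: eq_map => s /=; rewrite trlK.
apply: PTs_flatten; apply: (@PTs_map (fun s y => trl (exts (tfst y) (lst s)))).
  exact: PTs_exts (PT_fst (PT_snd PT_id)) (PTs_lst (PT_fst PT_id)).
exact: PTs_lst (PT_fst (PT_snd PT_id)).
Qed.

Lemma PTon_search D B : pbound D B ->
  (forall x i, D x ->
    tsize (foldl (fun z _ => search_step z x) (search_start x) (take i (clk x))) <= B x) ->
  PTon D (fun x => trl (search x)).
Proof.
move=> bB leB.
suff H : PTon D (fun x => foldl (fun z _ => search_step z x) (search_start x) (clk x)).
  apply: PTon_eq (@PTon_comp _ (fun=> True) tsnd _ (PT_snd PT_id) H _) => // x _.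
  by rewrite /search lstK.
apply: (PTon_fold (step := fun _ z x => search_step z x)) Pclk _ bB leB.
  by apply: PT_search_step; [apply: PT_fst (PT_snd PT_id) | apply: PT_snd (PT_snd PT_id)].
apply: PT_node PT_leaf (PTs_cons _ PTs_nil).
by apply: (@PTs_map (fun _ _ => Leaf)) Pclk; apply: PT_leaf.
Qed.
End Search.

(** * The tests of the two searches: directed cuts and membership in the answer *)

Definition teq (s t : seq tree) : bool :=
  all (fun q => truth (tfst q) == truth (tsnd q)) (tzip s t).

Lemma PTb_teq l l' : PTs l -> PTs l' -> PTb (fun x => teq (l x) (l' x)).
Proof.
move=> Pl Pl'.
apply: (@PTb_all (fun q _ => truth (tfst q) == truth (tsnd q))); last exact: PTs_zip.
apply: PTb_eq; apply: PTb_truth; [apply: PT_fst (PT_fst PT_id) | apply: PT_snd (PT_fst PT_id)].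
Qed.

(** The characteristic vector, over ordered pairs of vertices, of the directed cut of the placed
    vertices: [q] pairs an adjacency row with the mark of its vertex, [r] an entry of that row with
    the mark of the column vertex. *)
Definition cut_key (s g : tree) : seq tree :=
  flatten [seq [seq enc_bool (truth (tsnd q) && ~~ truth (tsnd r) && truth (tfst r))
                 | r <- tzip (lst (tfst q)) (lst s)] | q <- tzip (lst g) (lst s)].

Lemma PTs_cut_key f g : PT f -> PT g -> PTs (fun x => cut_key (f x) (g x)).
Proof.
move=> Pf Pg; suff H : PTs (fun y => cut_key (tfst y) (tsnd y)).
  exact: (PT_comp H (PT_node Pf Pg)).
pose k q y := trl [seq enc_bool (truth (tsnd q) && ~~ truth (tsnd r) && truth (tfst r))
                 | r <- tzip (lst (tfst q)) (lst (tfst y))].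
apply: (@PTon_eq _ (fun y => trl (flatten [seq lst a | a <-
   [seq k q y | q <- tzip (lst (tsnd y)) (lst (tfst y))]]))) => [y _|].
  by rewrite -map_comp; congr (trl (flatten _)); apply: eq_map => s /=; rewrite trlK.
apply: PTs_flatten; apply: (@PTs_map k).
  apply: (@PTs_map (fun r y =>
     enc_bool (truth (tsnd (tfst y)) && ~~ truth (tsnd r) && truth (tfst r)))).
    apply: PTb_and (PTb_truth (PT_fst (PT_fst PT_id))).
    apply: PTb_and (PTb_truth (PT_snd (PT_fst (PT_snd PT_id)))) _.
    exact: PTb_neg (PTb_truth (PT_snd (PT_fst PT_id))).
  exact: PTs_zip (PTs_lst (PT_fst (PT_fst PT_id))) (PTs_lst (PT_fst (PT_snd PT_id))).
exact: PTs_zip (PTs_lst (PT_snd PT_id)) (PTs_lst (PT_fst PT_id)).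
Qed.

Definition cut_acc k (s g : tree) : bool := count truth (cut_key s g) <= k.
Definition cut_sim (s t g : tree) : bool := teq (cut_key s g) (cut_key t g).

(** Here [x] pairs the graph with the answer. As [teq] compares truth values only, a state carrying
    ranks can be matched against a characteristic vector. *)
Definition mem_acc (s x : tree) : bool := has (fun m => teq (lst m) (lst s)) (lst (tsnd x)).
Definition mem_sim (s t x : tree) : bool := teq (lst s) (lst t).

Lemma PTb_cut_acc k : PTb (fun y => cut_acc k (tfst y) (tsnd y)).
Proof.
apply: PTb_count (PTb_truth PT_id) (PTs_cut_key _ _); [apply: PT_fst PT_id | apply: PT_snd PT_id].
Qed.

Lemma PTb_cut_sim : PTb (fun y => cut_sim (tfst y) (tfst (tsnd y)) (tsnd (tsnd y))).
Proof.
have Pe := PT_snd (PT_snd PT_id).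
exact: PTb_teq (PTs_cut_key (PT_fst PT_id) Pe) (PTs_cut_key (PT_fst (PT_snd PT_id)) Pe).
Qed.

Lemma PTb_mem_acc : PTb (fun y => mem_acc (tfst y) (tsnd y)).
Proof.
apply: (@PTb_has (fun m y => teq (lst m) (lst (tfst y)))).
  exact: PTb_teq (PTs_lst (PT_fst PT_id)) (PTs_lst (PT_fst (PT_snd PT_id))).
exact: PTs_lst (PT_snd (PT_snd PT_id)).
Qed.

Lemma PTb_mem_sim : PTb (fun y => mem_sim (tfst y) (tfst (tsnd y)) (tsnd (tsnd y))).
Proof. exact: PTb_teq (PTs_lst (PT_fst PT_id)) (PTs_lst (PT_fst (PT_snd PT_id))). Qed.

(** * Correctness of the search *)

Lemma enc_seqE A (enc : A -> tree) s : enc_seq enc s = trl (map enc s).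
Proof. by elim: s => //= a s ->. Qed.

Lemma enc_natE m : enc_nat m = trl (nseq m Leaf).
Proof. by rewrite /enc_nat enc_seqE; congr trl; elim: m 0 => //= m IH j; rewrite IH. Qed.

Lemma enc_natS m : enc_nat m.+1 = Node Leaf (enc_nat m).
Proof. by rewrite !enc_natE. Qed.

Lemma truth_enc_nat m : truth (enc_nat m) = (0 < m).
Proof. by rewrite enc_natE; case: m. Qed.

Lemma tsize_enc_nat m : tsize (enc_nat m) = (m.*2).+1.
Proof. by elim: m => // m IH; rewrite enc_natS /= IH. Qed.

Lemma tsize_trl_le M s : all (fun a => tsize a <= M) s -> tsize (trl s) <= (size s * M.+1).+1.
Proof.
elim: s => //= a s IH /andP[lea /IH les]; rewrite mulSn; lia.
Qed.

Section OrdEnum.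
Variable n : nat.
Implicit Types (f h : 'I_n -> tree).

Lemma nth_enum_map f (v : 'I_n) : nth Leaf [seq f w | w <- enum 'I_n] v = f v.
Proof. by rewrite (nth_map v) ?size_enum_ord // nth_ord_enum. Qed.

Lemma exts_enum c f :
  exts c [seq f v | v <- enum 'I_n] =
  [seq trl [seq if u == t then c else f u | u <- enum 'I_n]
     | t <- enum 'I_n & ~~ truth (f t)].
Proof.
set s := map f _; have size_s : size s = n by rewrite size_map size_enum_ord.
have tailsE : tails s = [seq trl (drop v s) | v : 'I_n <- enum 'I_n].
  by rewrite /tails size_s -val_enum_ord -map_comp.
have hd_drop (v : 'I_n) : tfst (trl (drop v s)) = f v.
  by rewrite -nth_enum_map -/s -[in RHS](addn0 v) -nth_drop; case: drop.
rewrite /exts tailsE filter_map -map_comp.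
rewrite (@eq_filter _ _ (fun t : 'I_n => ~~ truth (f t))) => [|t]; last by rewrite /= hd_drop.
apply: eq_map => t /=; congr trl; rewrite -map_comp; apply: eq_map => u /=.
rewrite hd_drop !trlK !size_drop size_s; congr (if _ then _ else _).
by have := ltn_ord u; have := ltn_ord t; rewrite -(inj_eq val_inj) /=; lia.
Qed.
End OrdEnum.

Section State.
Variable n : nat.
Implicit Types r : seq 'I_n.

(** The value [0] marks unplaced vertices; it is encoded by [Leaf], so that [st r]
    read as a characteristic vector is the set of placed vertices. *)
Definition pos r (v : 'I_n) : nat := if v \in r then (index v r).+1 else 0.

Definition st r : tree := enc_arr (pos r).

Lemma st_def r : st r = trl [seq enc_nat (pos r v) | v <- enum 'I_n].
Proof. exact: enc_seqE. Qed.

Lemma pos_gt0 r v : (0 < pos r v) = (v \in r).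
Proof. by rewrite /pos; case: ifP. Qed.

Lemma pos_rcons r v u : v \notin r ->
  pos (rcons r v) u = if u == v then (size r).+1 else pos r u.
Proof.
rewrite /pos mem_rcons in_cons -cats1 index_cat; case: eqP => [->|_] /=.
  by move=> /negbTE->; rewrite eqxx addn0.
by case: (u \in r).
Qed.

Lemma exts_st r :
  exts (enc_nat (size r).+1) (lst (st r)) =
  [seq st (rcons r v) | v <- enum 'I_n & v \notin r].
Proof.
rewrite st_def trlK exts_enum.
rewrite (@eq_filter _ _ (fun v => v \notin r)) => [|v]; last by rewrite truth_enc_nat pos_gt0.
apply/eq_in_map => v; rewrite mem_filter => /andP[vr _].
rewrite st_def; congr trl; apply: eq_map => u.
by rewrite pos_rcons //; case: ifP.
Qed.

Lemma tsize_st r : uniq r -> tsize (st r) <= (n * (n.*2).+2).+1.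
Proof.
move=> ur; rewrite st_def -[X in X * _](size_enum_ord n) -(size_map (fun v => enc_nat (pos r v))).
apply: tsize_trl_le; rewrite all_map; apply/allP => v _ /=.
rewrite tsize_enc_nat ltnS leq_double /pos; case: ifP => // vr.
apply: leq_trans (_ : size r <= n); first by rewrite index_mem.
by rewrite -(card_uniqP ur) -[leqRHS]card_ord max_card.
Qed.

(** Lengths start at 1, because the empty set is not a member of a linear tree. *)
Definition prefixes_good (good : pred {set 'I_n}) r : bool :=
  uniq r && all (fun j => good [set v in take j r]) (iota 1 (size r)).

Lemma prefixes_good_rcons good r v :
  prefixes_good good (rcons r v) =
  [&& prefixes_good good r, v \notin r & good [set u in rcons r v]].
Proof.
rewrite /prefixes_good rcons_uniq size_rcons -[X in iota 1 X]addn1 iotaD all_cat /= add1n andbT.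
rewrite -[in take (size r).+1 _](size_rcons r v) take_size.
rewrite (@eq_in_all _ _ (fun j => good [set v in take j r])) => [|j].
  by case: (uniq r); case: (v \in r); rewrite /= ?andbF.
by rewrite mem_iota add1n ltnS => /andP[_ lej]; rewrite -cats1 takel_cat.
Qed.
End State.

(** * Soundness, completeness and size of an abstract layered search *)

Section SearchSpec.
Variables (n : nat) (acc : tree -> tree -> bool) (sim : tree -> tree -> tree -> bool).
Variables (clk : tree -> seq tree) (x : tree) (good : pred {set 'I_n}).
Variables (same : rel {set 'I_n}) (N : nat).
Hypothesis accE : forall r, acc (st r) x = good [set v in r].
Hypothesis simE : forall r r', sim (st r) (st r') x = same [set v in r] [set v in r'].
Hypothesis size_clk : size (clk x) = n.
Hypothesis same_few : forall Xs, all good Xs ->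
  pairwise (fun X Y => ~~ same X Y) Xs -> size Xs <= N.
Implicit Types (r t : seq 'I_n) (R : seq (seq 'I_n)).

Definition complete r : bool := prefixes_good good r && (size r == n).

Definition extendable r : Prop := exists t, complete (r ++ t).

(** This is what permits keeping one sequence per class. Equal lengths may be assumed because only
    members of one layer are compared. *)
Hypothesis same_extendable : forall r r',
  prefixes_good good r -> prefixes_good good r' -> size r = size r' ->
  same [set v in r] [set v in r'] -> extendable r -> extendable r'.

Definition next_layer R : seq (seq 'I_n) :=
  dedup (fun r r' => same [set v in r] [set v in r'])
    [seq r <- flatten [seq [seq rcons r v | v <- enum 'I_n & v \notin r] | r <- R]
       | good [set v in r]].

Definition layer i : seq (seq 'I_n) := iter i next_layer [:: [::]].

Lemma next_st i R : all (fun r => size r == i) R ->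
  next acc sim x (enc_nat i.+1) (map (@st n) R) = map (@st n) (next_layer R).
Proof.
move=> sizeR; rewrite /next.
have -> : flatten [seq exts (enc_nat i.+1) (lst s) | s <- map (@st n) R] =
  map (@st n) (flatten [seq [seq rcons r v | v <- enum 'I_n & v \notin r] | r <- R]).
  rewrite map_flatten -!map_comp; congr flatten; elim: R sizeR => //= r R IH /andP[/eqP sr /IH->].
  by rewrite -sr exts_st -map_comp.
by rewrite filter_map (eq_filter accE) dedup_map (eq_dedup (fun r r' => simE r r')).
Qed.

Lemma mem_next_layer R r : r \in next_layer R ->
  exists r' v, [/\ r' \in R, v \notin r', r = rcons r' v & good [set u in r]].
Proof.
move/dedup_sub; rewrite mem_filter => /andP[gr /flatten_mapP[r' r'R /mapP[v]]].
by rewrite mem_filter => /andP[vr' _] Er; exists r', v; rewrite -Er.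
Qed.

Lemma layer_good i r : r \in layer i -> prefixes_good good r && (size r == i).
Proof.
elim: i r => [|i IH] r /=; first by rewrite inE => /eqP->.
case/mem_next_layer=> r' [v [/IH/andP[gr' /eqP<-] vr' -> g]].
by rewrite prefixes_good_rcons gr' vr' g size_rcons /=.
Qed.

(** The successor is for the initial layer, whose empty sequence has not been tested by [good], so
    that [same_few] does not apply to it. *)
Lemma size_layer i : size (layer i) <= N.+1.
Proof.
case: i => // i; apply: leqW; rewrite -(size_map (fun r => [set v in r])) same_few //=.
  by rewrite all_map; apply/allP => r /mem_next_layer[r' [v []]].
by rewrite pairwise_map; apply: pairwise_dedup.
Qed.

(** Follow a completion of a kept sequence by one vertex. If the result is discarded as a duplicate,
    its representative inherits extendability through [same_extendable]. *)
Lemma layer_extendable i : i <= n -> extendable [::] ->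
  exists2 r, r \in layer i & extendable r.
Proof.
move=> + ext0; elim: i => [|i IH] lti; first by exists [::].
have [r rL [[|v t] cr]] := IH (ltnW lti).
  have /andP[_ /eqP si] := layer_good rL.
  by move: cr; rewrite cats0 => /andP[_]; rewrite si => /eqP Ei; rewrite Ei ltnn in lti.
have /andP[pr /eqP si] := layer_good rL.
have ext : extendable (rcons r v) by exists t; rewrite cat_rcons.
have prv : prefixes_good good (rcons r v).
  move: cr; rewrite -cat_rcons /complete => /andP[+ _].
  by elim/last_ind: t {ext} => [|t w IHt]; rewrite ?cats0 // -rcons_cat prefixes_good_rcons
    => /andP[/IHt].
have /mem_dedup : rcons r v \in [seq r <- flatten [seq [seq rcons r v
    | v <- enum 'I_n & v \notin r] | r <- layer i] | good [set v in r]].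
  move: prv; rewrite prefixes_good_rcons => /and3P[_ vr g].
  rewrite mem_filter g; apply/flatten_mapP; exists r => //.
  by rewrite map_f // mem_filter vr mem_enum.
move=> /(_ (fun r r' => same [set v in r] [set v in r'])) /orP[|/hasP[r' r'L sm]].
  by exists (rcons r v).
exists r' => //; have /andP[pr' /eqP sr'] := layer_good (i := i.+1) r'L.
by apply: same_extendable ext; rewrite // size_rcons si sr'.
Qed.

Lemma search_iter i : i <= n ->
  foldl (fun z _ => search_step acc sim z x) (search_start clk x) (take i (clk x)) =
  Node (enc_nat i) (trl (map (@st n) (layer i))).
Proof.
move=> lein; have -> : forall (s : seq tree) z,
    foldl (fun z _ => search_step acc sim z x) z s = iter (size s) (search_step acc sim ^~ x) z.
  by elim=> //= a s IH z; rewrite IH -iterSr.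
rewrite size_takel ?size_clk //; elim: i {lein} => [|i IH] /=.
  rewrite /search_start st_def; congr (Node _ (trl [:: trl _])).
  rewrite (@eq_map _ _ _ (fun=> Leaf)) => [|v]; last by rewrite enc_natE.
  have map_const T (s : seq T) : [seq Leaf | _ <- s] = nseq (size s) Leaf.
    by elim: s => //= a s ->.
  by rewrite !map_const size_clk size_enum_ord.
rewrite IH /search_step /= -enc_natS trlK (@next_st i) //.
by apply/allP => r /layer_good/andP[].
Qed.

Lemma search_layer : search acc sim clk x = map (@st n) (layer n).
Proof. by rewrite /search -(take_size (clk x)) size_clk search_iter //= trlK. Qed.

Lemma search_found : truth (trl (search acc sim clk x)) ->
  exists2 r, complete r & tfst (trl (search acc sim clk x)) = st r.
Proof.
rewrite search_layer; case E: (layer n) => [|r R] //= _; exists r => //.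
by apply: layer_good; rewrite E mem_head.
Qed.

Lemma search_complete r : complete r -> truth (trl (search acc sim clk x)).
Proof.
move=> cr; have [|r' + _] := layer_extendable (leqnn n); first by exists r.
by rewrite search_layer; case: (layer n).
Qed.

(** The state consists of a counter of size at most 2n + 1 and a list of at most N + 1 partial
    arrangements; the 3 collects the constants of both and of the enclosing node. *)
Lemma tsize_search_iter i :
  tsize (foldl (fun z _ => search_step acc sim z x) (search_start clk x) (take i (clk x)))
  <= n.*2 + N.+1 * (n * (n.*2).+2).+2 + 3.
Proof.
wlog lein : i / i <= n.
  move=> H; case: (leqP i n) => [|/ltnW lt]; first exact: H.
  have := H n (leqnn n); rewrite !take_oversize ?size_clk //.
rewrite search_iter //= tsize_enc_nat.
have : tsize (trl (map (@st n) (layer i))) <= (N.+1 * (n * (n.*2).+2).+2).+1.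
  apply: leq_trans (tsize_trl_le (M := (n * (n.*2).+2).+1) _) _.
    by rewrite all_map; apply/allP => r /layer_good/andP[/andP[ur _] _] /=; apply: tsize_st.
  by rewrite size_map ltnS leq_mul2r size_layer orbT.
by lia.
Qed.
End SearchSpec.

(** * Directed cuts *)

Section DirectedCut.
Variables (V : finType) (G : sgraph V).
Implicit Types X Y P Q : {set V}.

Definition dcut X : {set V * V} :=
  [set p | [&& p.1 \in X, p.2 \notin X & G p.1 p.2]].

(** Orienting each cut edge from inside [X] to outside is a bijection: the intersection of the edge
    with [X] recovers its source. *)
Lemma deg_dcut X : deg G X = #|dcut X|.
Proof.
have endI u w : u \in X -> w \notin X -> [set u; w] :&: X = [set u].
  move=> uX wX; apply/setP=> v; rewrite !inE.
  by case: (eqVneq v u) => [->|_] /=; [rewrite uX | case: eqP => // ->; apply: negbTE].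
rewrite -(@card_in_imset _ _ (fun p => [set p.1; p.2]) (dcut X)); last first.
  move=> [u w] [u' w']; rewrite !inE /= => /and3P[uX wX _] /and3P[uX' wX' _] E.
  have /set1_inj Eu : [set u] = [set u'] by rewrite -(endI _ w) // E endI.
  have : w \in [set u'; w'] by rewrite -E set22.
  rewrite -{u' uX'}Eu in E *; rewrite !inE => /orP[/eqP Ew|/eqP->] //.
  by rewrite Ew uX in wX.
apply: eq_card => e; rewrite inE; apply/andP/imsetP.
  case=> /imsetP[[u w]]; rewrite inE /= => Guw -> {e}.
  case uX: (u \in X); case wX: (w \in X) => c1.
  - case/cards1P: c1 => v Ev; suff Euw : u = w by rewrite Euw adj_irr in Guw.
    have: u \in [set v] by rewrite -Ev !inE eqxx.
    have: w \in [set v] by rewrite -Ev !inE eqxx orbT.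
    by rewrite !inE => /eqP-> /eqP->.
  - by exists (u, w); rewrite // inE /= uX wX.
  - by exists (w, u); rewrite /= 1?setUC // inE /= uX wX adj_sym.
  case/cards1P: c1 => v /setP/(_ v); rewrite !inE eqxx => /andP[/orP[]/eqP->];
    by rewrite ?uX ?wX.
case=> [[u w]]; rewrite inE /= => /and3P[uX wX Guw] -> {e}.
by rewrite endI // cards1; split=> //; apply/imsetP; exists (u, w); rewrite ?inE.
Qed.

Lemma deg1_le v : deg G [set v] <= vdeg G v.
Proof.
rewrite deg_dcut -(@card_in_imset _ _ snd).
  apply: subset_leq_card; apply/subsetP => w /imsetP[[u w']].
  by rewrite !inE /= => /and3P[/eqP-> _ Guw] ->.
by move=> [u w] [u' w']; rewrite !inE /= => /and3P[/eqP-> _ _] /and3P[/eqP-> _ _] ->.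
Qed.

(** Two sets with the same directed cut differ by unions of components. *)
Lemma dcut_eq_diff X Y a b : dcut X = dcut Y ->
  a \in X -> a \notin Y -> G a b -> (b \in X) && (b \notin Y).
Proof.
move=> E aX aY Gab; case bX: (b \in X) => /=.
  apply/negP => bY; have: (b, a) \in dcut Y by rewrite inE /= bY aY adj_sym.
  by rewrite -E inE /= aX andbF.
have: (a, b) \in dcut X by rewrite inE /= aX bX.
by rewrite E inE /= (negbTE aY).
Qed.

(** Every arc (a, b) leaving Y ∪ P leaves X ∪ P. If a were in Y but not in X, so would be b, by
    [dcut_eq_diff]. If b were in X, hence in X but not in Y, so would be a, which would then have to
    lie in P, a set disjoint from X. *)
Lemma deg_replace X Y P : dcut X = dcut Y -> [disjoint P & X] ->
  deg G (Y :|: P) <= deg G (X :|: P).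
Proof.
move=> E dPX; rewrite !deg_dcut subset_leq_card //; apply/subsetP => -[a b].
rewrite !inE /= !negb_or => /and3P[aYP /andP[bY bP] Gab]; rewrite Gab bP !andbT.
apply/andP; split.
  case aX: (a \in X) => //=; case/orP: aYP => // aY.
  by have := dcut_eq_diff (esym E) aY (negbT aX) Gab; rewrite (negbTE bY).
apply/negP => bX; rewrite adj_sym in Gab.
have /andP[aX aY] := dcut_eq_diff E bX bY Gab.
by rewrite (negbTE aY) /= in aYP; rewrite (disjointFr dPX aYP) in aX.
Qed.

(** An arc leaving the large set ends in X but outside Y, so by [dcut_eq_diff] it also starts there.
    Its source can then only belong to Q, so the arc leaves Q. *)
Lemma deg_leftover X Y Q : dcut X = dcut Y -> Q \subset X ->
  deg G (Y :|: ~: X :|: Q) <= deg G Q.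
Proof.
move=> E QX; rewrite !deg_dcut subset_leq_card //; apply/subsetP => -[a b].
rewrite !inE /= !negb_or negbK => /and3P[aYQ /andP[/andP[bY bX] ->] Gab].
have Gba : G b a by rewrite adj_sym.
have /andP[aX aY] := dcut_eq_diff E bX bY Gba.
by rewrite aX (negbTE aY) /= in aYQ; rewrite aYQ Gab.
Qed.
End DirectedCut.

Lemma card_small_sets (T : finType) k :
  #|[set D : {set T} | #|D| <= k]| <= #|T|.+1 ^ k.
Proof.
rewrite -card_option -[k in _ ^ k]card_ord -card_ffun.
pose f (h : {ffun 'I_k -> option T}) := [set a | Some a \in codom h].
apply: leq_trans (leq_imset_card f _); apply: subset_leq_card.
apply/subsetP => D; rewrite inE => leD; apply/imsetP.
exists [ffun i : 'I_k => onth (enum D) i] => //; apply/setP => a; rewrite inE.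
apply/idP/codomP => [aD|[i]]; last first.
  by rewrite ffunE => Ea; rewrite -mem_enum; apply/onthP; exists i.
have ia : index a (enum D) < k by apply: leq_trans leD; rewrite cardE index_mem mem_enum.
by exists (Ordinal ia); rewrite ffunE onthE (nth_map a) ?nth_index ?index_mem ?mem_enum.
Qed.

Section Prefixes.
Variable n : nat.
Implicit Types (r t : seq 'I_n) (good : pred {set 'I_n}).

Lemma prefixes_good_catl good r t : prefixes_good good (r ++ t) -> prefixes_good good r.
Proof.
elim/last_ind: t => [|t w IH]; first by rewrite cats0.
by rewrite -rcons_cat prefixes_good_rcons => /andP[/IH].
Qed.

Lemma completeE good r : complete good r <->
  [/\ uniq r, size r = n & forall i, 1 <= i <= n -> good [set v in take i r]].
Proof.
split=> [/andP[/andP[ur /allP gr] /eqP sr]|[ur sr gr]].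
  by split=> // i lein; apply: gr; rewrite mem_iota sr; lia.
rewrite /complete /prefixes_good ur sr eqxx andbT; apply/allP => i.
by rewrite mem_iota => lein; apply: gr; lia.
Qed.

Lemma uniq_size_mem r v : uniq r -> size r = n -> v \in r.
Proof.
move=> ur sr; have sub : {subset r <= enum 'I_n} by move=> u _; rewrite mem_enum.
have [|_ ->] := uniq_min_size ur sub; first by rewrite sr size_enum_ord.
by rewrite mem_enum.
Qed.

Definition cut_good (G : sgraph 'I_n) k (X : {set 'I_n}) : bool := deg G X <= k.
Definition same_cut (G : sgraph 'I_n) (X Y : {set 'I_n}) : bool := dcut G X == dcut G Y.

(** Replacing [r] by [r'] in a complete sequence [r ++ t]: the vertices of [r]
    missing from [r'] form components untouched by the cut and are moved to the
    end, in the order in which [r] visits them. *)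
Lemma same_cut_extendable G k r r' :
  prefixes_good (cut_good G k) r -> prefixes_good (cut_good G k) r' ->
  same_cut G [set v in r] [set v in r'] ->
  extendable (cut_good G k) r -> extendable (cut_good G k) r'.
Proof.
move=> pr pr' /eqP E [t /andP[prt /eqP srt]].
have urt : uniq (r ++ t) by case/andP: prt.
have mem_rt v : (v \in r) || (v \in t) by rewrite -mem_cat uniq_size_mem.
have dis v : v \in t -> v \notin r.
  by move: urt; rewrite cat_uniq => /and3P[_ /hasPn H _] /H.
pose new (s : seq 'I_n) := [seq v <- s | v \notin r'].
(* Whatever vertices of [t] are skipped, the set reached is r' ∪ t, which [deg_replace] compares
   with r ∪ t. *)
have p1 : prefixes_good (cut_good G k) (r' ++ new t).
  elim/last_ind: t {srt mem_rt urt} prt dis => [|t v IH] prt dis; first by rewrite cats0.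
  move: prt; rewrite -rcons_cat prefixes_good_rcons => /and3P[prt vrt g].
  have {}IH : prefixes_good (cut_good G k) (r' ++ new t).
    by apply: IH => // u ut; apply: dis; rewrite mem_rcons in_cons ut orbT.
  rewrite /new filter_rcons; case: ifPn => // vr'.
  rewrite -rcons_cat prefixes_good_rcons IH.
  rewrite mem_cat negb_or vr' mem_filter vr' /=.
  have -> : v \notin t by move: vrt; rewrite mem_cat negb_or => /andP[].
  apply: leq_trans g.
  have -> : [set u in rcons (r ++ t) v] = [set u in r] :|: [set u in rcons t v].
    by apply/setP => u; rewrite !inE rcons_cat mem_cat.
  have -> : [set u in rcons (r' ++ [seq u <- t | u \notin r']) v] =
            [set u in r'] :|: [set u in rcons t v].
    apply/setP => u; rewrite !inE rcons_cat mem_cat !mem_rcons !in_cons mem_filter.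
    by case: (u \in r').
  apply: deg_replace E _; rewrite disjoint_subset; apply/subsetP => u.
  by rewrite !inE => /dis.
have p2 : prefixes_good (cut_good G k) ((r' ++ new t) ++ new r).
  (* Induction on the prefixes [s] of [r]. Since [t] is the complement of [r], the set reached has
     the form treated by [deg_leftover] with Q = s, and its degree is at most that of the prefix
     [s]. *)
  have : exists q, r = r ++ q by exists [::]; rewrite cats0.
  move: {2 3}r; elim/last_ind => [|s v IH] [q Er]; first by rewrite cats0.
  have {}IH : prefixes_good (cut_good G k) ((r' ++ new t) ++ new s).
    by apply: IH; exists (v :: q); rewrite -cat_rcons.
  rewrite /new filter_rcons; case: ifPn => // vr'.
  have := pr; rewrite Er => /prefixes_good_catl; rewrite prefixes_good_rcons => /and3P[_ vs g].
  have vr : v \in r by rewrite Er mem_cat mem_rcons mem_head.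
  have vt : v \notin t := contraL (@dis v) vr.
  rewrite -rcons_cat prefixes_good_rcons IH !mem_cat !mem_filter vr'.
  rewrite (negbTE vr') (negbTE vt) (negbTE vs) /=.
  apply: leq_trans g.
  have sr : [set u in rcons s v] \subset [set u in r].
    by apply/subsetP => u; rewrite !inE Er mem_cat => ->.
  apply: leq_trans (deg_leftover E sr); rewrite leq_eqVlt; apply/orP; left; apply/eqP.
  congr deg; apply/setP => u; have := mem_rt u; have := @dis u.
  rewrite !inE rcons_cat !(mem_cat, mem_rcons, in_cons, mem_filter).
  case: (u \in r') => //=; case: (eqVneq u v) => [->|_] /=; first by rewrite vr !orbT.
  by case: (u \in t); case: (u \in r) => //= H; rewrite ?orbF //; have := H isT.
exists (new t ++ new r); rewrite catA /complete p2.
have /andP[u2 _] := p2; rewrite -(card_uniqP u2) -[X in _ == X]card_ord.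
apply/eqP/eq_card => v; rewrite !inE !mem_cat !mem_filter.
by have := mem_rt v; case: (v \in r'); case: (v \in r); rewrite //= ?orbT ?orbF.
Qed.
End Prefixes.

(** * Arrangements and search instances *)

Section Arrangements.
Variables (n : nat) (G : sgraph 'I_n).
Implicit Types (r : seq 'I_n) (phi : 'I_n -> nat).

Lemma alpha_arr_leP phi k :
  reflect (forall i, 1 <= i <= n -> deg G [set v | phi v <= i] <= k) (alpha_arr G phi <= k).
Proof.
rewrite /alpha_arr card_ord; apply: (iffP idP) => [le i lein|le].
  by apply: leq_trans le; apply: leq_bigmax_seq => //; rewrite mem_index_iota; lia.
apply/bigmax_leqP_seq => i; rewrite mem_index_iota => lein _.
by apply: le; lia.
Qed.

Lemma pos_take r i : uniq r -> size r = n -> [set v | pos r v <= i] = [set v in take i r].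
Proof.
move=> ur sr; apply/setP=> v; rewrite !inE /pos.
by have vr := uniq_size_mem v ur sr; rewrite vr in_take.
Qed.

Lemma pos_arrangement r : uniq r -> size r = n -> arrangement (pos r).
Proof.
move=> ur sr; have mem_r v := uniq_size_mem v ur sr; split=> [u v|i].
  rewrite /pos !mem_r => -[E].
  by rewrite -(nth_index u (mem_r u)) E nth_index.
rewrite card_ord; split=> [[v <-]|/andP[i1 lein]].
  by rewrite pos_gt0 mem_r /pos mem_r; have := mem_r v; rewrite -index_mem sr.
case: i i1 lein => // i _ ltin; have lti : i < size r by rewrite sr.
by exists (nth (Ordinal ltin) r i); rewrite /pos mem_r index_uniq.
Qed.

Lemma arrangement_seq phi : arrangement phi ->
  exists r, [/\ uniq r, size r = n & forall i, [set v | phi v <= i] = [set v in take i r]].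
Proof.
case=> inj_phi im_phi.
have {}im_phi j : (exists v, phi v = j) <-> 0 < j <= n by rewrite im_phi card_ord.
pose r := sort (fun u v => phi u <= phi v) (enum 'I_n).
have ur : uniq r by rewrite sort_uniq enum_uniq.
have sr : size r = n by rewrite size_sort size_enum_ord.
exists r; split=> // i.
(* Both lists are strictly increasing with the same members. *)
have Er : map phi r = iota 1 n.
  apply: (irr_sorted_eq ltn_trans ltnn); last first.
  - move=> j; rewrite mem_iota add1n ltnS.
    apply/mapP/idP => [[v _ ->]|/im_phi[v <-]]; first by apply/im_phi; exists v.
    by exists v; rewrite // mem_sort mem_enum.
  - exact: iota_ltn_sorted.
  rewrite ltn_sorted_uniq_leq (map_inj_uniq inj_phi) ur sorted_map.
  by apply: sort_sorted => u v; apply: leq_total.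
apply/setP => v; rewrite !inE -(mem_map inj_phi) map_take Er take_iota mem_iota.
have := uniq_size_mem v ur sr; rewrite -(mem_map inj_phi) Er mem_iota.
by lia.
Qed.

Lemma complete_cutP k :
  (exists r, complete (cut_good G k) r) <-> (exists2 phi, arrangement phi & alpha_arr G phi <= k).
Proof.
split=> [[r /completeE[ur sr gr]]|[phi /arrangement_seq[r [ur sr Er]] /alpha_arr_leP le]].
  exists (pos r); first exact: pos_arrangement.
  by apply/alpha_arr_leP => i lein; rewrite pos_take //; apply: gr.
by exists r; apply/completeE; split=> // i lein; rewrite -Er; apply: le.
Qed.
End Arrangements.

(** * The search for arrangements of bounded cutwidth *)

Section CutSearch.
Variables (G : subcubic) (k : nat).
Let n := order G.
Implicit Types r : seq 'I_n.

Lemma lst_enc_graph : lst (enc_graph G) =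
  [seq trl [seq enc_bool (G v w) | w <- enum 'I_n] | v <- enum 'I_n].
Proof. by rewrite /enc_graph enc_seqE trlK; apply: eq_map => v; rewrite enc_seqE. Qed.

Lemma tzip_map A (f h : A -> tree) s :
  tzip (map f s) (map h s) = [seq Node (f a) (h a) | a <- s].
Proof. by elim: s => //= a s ->. Qed.

Lemma teq_map A (f h : A -> tree) s :
  teq (map f s) (map h s) = all (fun a => truth (f a) == truth (h a)) s.
Proof. by rewrite /teq tzip_map all_map. Qed.

Lemma cut_keyE r : cut_key (st r) (enc_graph G) =
  [seq enc_bool (p \in dcut G [set v in r]) | p <- [seq (v, w) | v <- enum 'I_n, w <- enum 'I_n]].
Proof.
rewrite /cut_key lst_enc_graph st_def trlK tzip_map map_flatten.
congr flatten; rewrite -[LHS]map_comp -[RHS]map_comp; apply: eq_map => v /=.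
rewrite trlK tzip_map -[LHS]map_comp -[RHS]map_comp; apply: eq_map => w /=.
by rewrite !inE /= !truth_enc_nat !pos_gt0 truth_enc_bool andbA.
Qed.

Lemma cut_accE r : cut_acc k (st r) (enc_graph G) = cut_good G k [set v in r].
Proof.
rewrite /cut_acc /cut_good deg_dcut cut_keyE count_map; congr (_ <= _).
set X := dcut _ _; rewrite (@eq_count _ _ (mem X)) => [|p]; last by rewrite /= truth_enc_bool.
rewrite -size_filter -(card_uniqP (filter_uniq _ _)); last first.
  by apply: allpairs_uniq => [||[u v] [u' v'] _ _ /=]; rewrite ?enum_uniq.
apply: eq_card => -[u v]; rewrite mem_filter /=.
by rewrite allpairs_f ?mem_enum ?andbT.
Qed.

Lemma cut_simE r r' :
  cut_sim (st r) (st r') (enc_graph G) = same_cut G [set v in r] [set v in r'].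
Proof.
rewrite /cut_sim /same_cut !cut_keyE teq_map; apply/allP/eqP => [E|-> //].
by apply/setP => -[u v]; have := E (u, v) (allpairs_f _ (mem_enum _ u) (mem_enum _ v));
  rewrite !truth_enc_bool => /eqP.
Qed.

Lemma size_clk_graph : size (lst (enc_graph G)) = n.
Proof. by rewrite lst_enc_graph size_map size_enum_ord. Qed.

Lemma same_cut_few (Xs : seq {set 'I_n}) : all (cut_good G k) Xs ->
  pairwise (fun X Y => ~~ same_cut G X Y) Xs -> size Xs <= (n * n).+1 ^ k.
Proof.
move=> gX pX; rewrite -(size_map (dcut G)).
have uX : uniq (map (dcut G) Xs) by rewrite uniq_pairwise pairwise_map.
rewrite -(card_uniqP uX).
apply: leq_trans (_ : #|[set D : {set 'I_n * 'I_n} | #|D| <= k]| <= _).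
  apply: subset_leq_card; apply/subsetP => D /mapP[X XX ->].
  by rewrite inE -deg_dcut; apply: (allP gX).
by apply: leq_trans (card_small_sets _ _) _; rewrite card_prod card_ord.
Qed.
End CutSearch.

Lemma order_le_tsize (G : subcubic) : order G <= tsize (enc_graph G).
Proof. by rewrite -size_clk_graph -[X in tsize X]lstK size_le_tsize_trl. Qed.

(** The bound of [tsize_search_iter], with [m x] standing for the order and [N] for the number of
    classes as a function of it. *)
Lemma pbound_search D (N : nat -> nat) (m : tree -> nat) :
  pbound D m -> pbound D (fun x => N (m x)) ->
  pbound D (fun x => (m x).*2 + (N (m x)).+1 * (m x * ((m x).*2).+2).+2 + 3).
Proof.
move=> bm bN; pose c k := pbound_const D k.
apply: (@pbound_le _ _ (fun x =>
   2 * m x + (N (m x) + 1) * (m x * (2 * m x + 2) + 2) + 3)) => [x _|].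
  by rewrite -!mul2n; lia.
have b2 := pbound_mul (c 2) bm.
apply: pbound_add (pbound_add b2 (pbound_mul (pbound_add bN (c 1)) _)) (c 3).
exact: pbound_add (pbound_mul bm (pbound_add b2 (c 2))) (c 2).
Qed.

Definition is_graph (x : tree) : Prop := exists G, x = enc_graph G.

Definition cut_search k : tree -> seq tree := search (cut_acc k) cut_sim lst.

Lemma PTon_cut_search k : PTon is_graph (fun g => trl (cut_search k g)).
Proof.
pose N m := (m * m).+1 ^ k.
pose B (s : nat) := s.*2 + (N s).+1 * (s * (s.*2).+2).+2 + 3.
apply: (@PTon_search _ _ _ (PTb_cut_acc k) PTb_cut_sim (PTs_lst PT_id) _ (fun x => B (tsize x))).
  apply: pbound_search (pbound_tsize _) (pbound_exp _ _).
  apply: (@pbound_le _ _ (fun x => tsize x * tsize x + 1)) => [x _|]; first by rewrite addn1.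
  apply: pbound_add (pbound_mul _ _) (pbound_const _ _); exact: pbound_tsize.
move=> _ i [G ->].
have := @tsize_search_iter _ _ _ lst (enc_graph G) _ _ _ (@cut_accE G k) (@cut_simE G)
  (size_clk_graph G) (@same_cut_few G k) i.
move/leq_trans; apply; rewrite /B; have lem := order_le_tsize G.
have leN : N (order G) <= N (tsize (enc_graph G)).
  by rewrite /N; case: (k) => // k'; rewrite leq_exp2r // ltnS leq_mul.
rewrite leq_add2r leq_add ?leq_double // leq_mul // !ltnS leq_mul // !ltnS.
by rewrite leq_double.
Qed.

Lemma cut_search_found k (G : subcubic) :
  truth (trl (cut_search k (enc_graph G))) ->
  exists phi, [/\ arrangement phi, alpha_arr G phi <= k
                & tfst (trl (cut_search k (enc_graph G))) = enc_arr phi].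
Proof.
move/(@search_found _ _ _ _ _ _ _ (@cut_accE G k) (@cut_simE G) (size_clk_graph G)).
case=> r /completeE[ur sr gr] E; exists (pos r); split=> //; first exact: pos_arrangement.
by apply/alpha_arr_leP => i lein; rewrite pos_take //; apply: gr.
Qed.

Lemma cut_search_complete k (G : subcubic) phi :
  arrangement phi -> alpha_arr G phi <= k -> truth (trl (cut_search k (enc_graph G))).
Proof.
move=> arr le; have [r cr] : exists r, complete (cut_good G k) r.
  by apply/complete_cutP; exists phi.
apply: (@search_complete _ _ _ _ _ _ _ (@cut_accE G k) (@cut_simE G) (size_clk_graph G) _ _ cr).
by move=> r1 r2 p1 p2 _; apply: same_cut_extendable.
Qed.

(** * The search inside the answer to the query *)

Definition answered (x : tree) : Prop :=
  exists G y, x = Node (enc_graph G) y /\ solution (p := reassembling_problem) G y.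

Definition query_rows (x : tree) : seq tree := lst (tfst x).

Definition mem_search : tree -> seq tree := search mem_acc mem_sim query_rows.

Section MemSearch.
Variables (G : subcubic) (ls : seq {set 'I_(order G)}).
Let n := order G.
Let x := Node (enc_graph G) (enc_seq (@enc_set n) ls).
Implicit Types r : seq 'I_n.

Lemma lst_enc_set (X : {set 'I_n}) :
  lst (enc_set X) = [seq enc_bool (v \in X) | v <- enum 'I_n].
Proof. by rewrite /enc_set enc_seqE trlK. Qed.

Lemma mem_accE r : mem_acc (st r) x = ([set v in r] \in ls).
Proof.
rewrite /mem_acc /x /= enc_seqE trlK has_map -has_pred1; apply: eq_has => X /=.
rewrite lst_enc_set st_def trlK teq_map eq_sym; apply/allP/eqP => [E|<- v _].
  apply/setP => v; have := E v (mem_enum _ v).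
  by rewrite truth_enc_bool truth_enc_nat pos_gt0 inE => /eqP.
by rewrite truth_enc_bool truth_enc_nat pos_gt0 inE.
Qed.

Lemma mem_simE r r' : mem_sim (st r) (st r') x = ([set v in r] == [set v in r']).
Proof.
rewrite /mem_sim !st_def !trlK teq_map; apply/allP/eqP => [E|/setP E v _].
  apply/setP => v; have := E v (mem_enum _ v).
  by rewrite !truth_enc_nat !pos_gt0 !inE => /eqP.
by have := E v; rewrite !truth_enc_nat !pos_gt0 !inE => ->.
Qed.

Lemma mem_few (Xs : seq {set 'I_n}) : all (mem ls) Xs ->
  pairwise (fun X Y => ~~ (X == Y)) Xs -> size Xs <= size ls.
Proof.
rewrite -uniq_pairwise => /allP sub uX; exact: uniq_leq_size uX sub.
Qed.

Lemma size_query_rows : size (query_rows x) = n.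
Proof. exact: size_clk_graph. Qed.

(** The two sequences place the same set of vertices, so the same completion serves both. *)
Lemma mem_extendable r r' : prefixes_good (mem ls) r -> prefixes_good (mem ls) r' ->
  size r = size r' -> [set v in r] == [set v in r'] ->
  extendable (mem ls) r -> extendable (mem ls) r'.
Proof.
move=> _ pr' ss /eqP E [t /andP[prt srt]]; exists t.
rewrite /complete !size_cat -ss -size_cat srt andbT.
have mem_cat_eq q u : (u \in r' ++ q) = (u \in r ++ q).
  by have /setP/(_ u) := E; rewrite !inE !mem_cat => ->.
elim/last_ind: t {srt} prt => [|t v IH]; first by rewrite !cats0.
rewrite -!rcons_cat !prefixes_good_rcons !mem_cat_eq => /and3P[/IH -> -> g] /=.
have <- : [set u in rcons (r ++ t) v] = [set u in rcons (r' ++ t) v].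
  by apply/setP => u; rewrite !inE !mem_rcons !in_cons mem_cat_eq.
by [].
Qed.
End MemSearch.

Lemma card_linear_tree n (L : {set {set 'I_n}}) : linear_tree L -> #|L| <= n.*2.+1.
Proof.
case=> s _ ->; rewrite cardsU; apply: leq_trans (leq_subr _ _) _.
(* There are [n] singletons, and at most n + 1 prefixes because their index ranges over
   ['I_n.+1]. *)
rewrite -addnn -addnS leq_add //.
  by apply: leq_trans (leq_imset_card _ _) _; rewrite cardsT card_ord.
apply: leq_trans (leq_imset_card _ _) _; apply: leq_trans (max_card _) _.
by rewrite !card_ord.
Qed.

Lemma linear_tree_prefix n (s : seq 'I_n) i :
  uniq s -> size s = n -> 1 <= i <= n -> [set v in take i s] \in linear_tree_of s.
Proof.
move=> us ss /andP[i1 lein]; rewrite inE; apply/orP.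
case: (ltnP 1 i) => [lt1i|lei1]; [right | left].
  have lti : i < #|'I_n|.+1 by rewrite card_ord ltnS.
  by apply/imsetP; exists (Ordinal lti); rewrite ?inE.
have -> : i = 1 by apply/eqP; rewrite eqn_leq lei1.
case: s us ss => [|v s] _ /= ss; first by lia.
by apply/imsetP; exists v; rewrite ?inE // take0; apply/setP => u; rewrite !inE.
Qed.

Lemma size_linear_tree n (L : {set {set 'I_n}}) (ls : seq {set 'I_n}) :
  linear_tree L -> uniq ls -> ls =i L -> size ls <= n.*2.+1.
Proof.
by move=> lL uls Els; rewrite -(card_uniqP uls) (eq_card Els) card_linear_tree.
Qed.

(** The degree bound enters here: the 3 pays for the singletons, while the larger members are
    prefixes of the arrangement. *)
Lemma alpha_tree_le (G : subcubic) r phi : uniq r -> size r = order G ->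
  (forall i, [set v | phi v <= i] = [set v in take i r]) ->
  alpha_tree G (linear_tree_of r) <= maxn 3 (alpha_arr G phi).
Proof.
move=> ur sr Er; apply/bigmax_leqP => X; rewrite inE => /orP[] /imsetP[].
  by move=> v _ ->; rewrite leq_max (leq_trans (deg1_le _ _)) ?subcubicP.
move=> i; rewrite inE => lt1i ->; rewrite leq_max -Er; apply/orP; right.
move: (leqnn (alpha_arr G phi)) => /alpha_arr_leP; apply.
rewrite (ltnW lt1i) /=; apply: leq_trans (_ : _ <= #|'I_(order G)|) _.
  by rewrite -ltnS ltn_ord.
by rewrite card_ord.
Qed.

Lemma PTon_mem_search : PTon answered (fun x => trl (mem_search x)).
Proof.
pose N m := m.*2.+1.
pose B (s : nat) := s.*2 + (N s).+1 * (s * (s.*2).+2).+2 + 3.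
apply: (@PTon_search _ _ _ PTb_mem_acc PTb_mem_sim (PTs_lst (PT_fst PT_id)) _
  (fun x => B (tsize x))).
  apply: pbound_search (pbound_tsize _) _.
  apply: (@pbound_le _ _ (fun x => 2 * tsize x + 1)) => [x _|]; first by rewrite /N; lia.
  exact: pbound_add (pbound_mul (pbound_const _ _) (pbound_tsize _)) (pbound_const _ _).
move=> _ i [G [y [-> [L [lL _] [ls [uls Els ->]]]]]].
have few Xs : all (mem ls) Xs -> pairwise (fun X Y => ~~ (X == Y)) Xs -> size Xs <= N (order G).
  by move=> aX /(mem_few aX)/leq_trans; apply; apply: size_linear_tree lL uls Els.
have := @tsize_search_iter _ _ _ _ _ _ _ _ (@mem_accE G ls) (@mem_simE G ls)
  (size_query_rows ls) few i.
move/leq_trans; apply; rewrite /B; set x := Node _ _.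
have lem : order G <= tsize x := leq_trans (order_le_tsize G) (leqW (leq_addr _ _)).
rewrite leq_add2r leq_add ?leq_double // leq_mul // !ltnS ?leq_double //.
by rewrite leq_mul // !ltnS leq_double.
Qed.

Definition cutwidth_ge (G : subcubic) k : Prop :=
  forall phi, arrangement phi -> k <= alpha_arr G phi.

(** The search succeeds because the enumeration behind [L] is a chain in [L]. Whichever chain it
    returns, its prefixes are members of [L], so its cost is at most the optimal tree value; that is
    at most [maxn 3 (alpha_arr G phi)] for every arrangement [phi], and cutwidth at least 3 removes
    the maximum. *)
Lemma mem_search_solution (G : subcubic) y :
  solution (p := reassembling_problem) G y -> cutwidth_ge G 3 ->
  solution (p := arrangement_problem) G (tfst (trl (mem_search (Node (enc_graph G) y)))).
Proof.
case=> L [lL optL] [ls [uls Els ->]] cw3.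
have [s [us mem_s] EL] := lL.
have ss : size s = order G.
  by rewrite -(card_uniqP us) -[RHS]card_ord; apply: eq_card => v; rewrite mem_s inE.
have cs : complete (mem ls) s.
  by apply/completeE; split=> // i lein; rewrite /= Els EL linear_tree_prefix.
have := @search_complete _ _ _ _ _ _ _ (@mem_accE G ls) (@mem_simE G ls)
  (size_query_rows ls) (@mem_extendable G ls) _ cs.
case/(@search_found _ _ _ _ _ _ _ (@mem_accE G ls) (@mem_simE G ls) (size_query_rows ls)).
move=> r /completeE[ur sr gr] Er; exists (pos r); last exact: Er.
split=> [|phi arr]; first exact: pos_arrangement.
have le1 : alpha_arr G (pos r) <= alpha_tree G L.
  apply/alpha_arr_leP => i lein; rewrite pos_take //.
  by apply: (@leq_bigmax_cond _ _ (deg G)); rewrite -Els; apply: gr.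
have [t [ut st Et]] := arrangement_seq arr.
have lt : linear_tree (linear_tree_of t) by exists t => //; split=> // v; apply: uniq_size_mem.
apply: leq_trans le1 (leq_trans (optL _ lt) (leq_trans (alpha_tree_le ut st Et) _)).
by rewrite geq_max leqnn cw3.
Qed.

(** Used both for the charge of an oracle call and for the input size of the second search. The
    factors are the number of members, at most 2n + 1, and the size of one of them with its list
    cell: 4 per bit, plus 2. *)
Lemma tsize_solution (G : subcubic) y : solution (p := reassembling_problem) G y ->
  tsize y <= (2 * tsize (enc_graph G) + 1) * (4 * tsize (enc_graph G) + 2) + 1.
Proof.
case=> L [lL _] [ls [uls Els ->]]; set s := tsize (enc_graph G).
have les : order G <= s := order_le_tsize G.
rewrite enc_seqE.
have : tsize (trl (map (@enc_set (order G)) ls)) <= (size ls * (4 * order G + 2)).+1.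
  rewrite -(size_map (@enc_set (order G)) ls) addn2.
  apply: tsize_trl_le; rewrite all_map; apply/allP => X _ /=.
  rewrite /enc_set enc_seqE; apply: leq_trans (tsize_trl_le (M := 3) _) _.
    by rewrite all_map; apply/allP => v _ /=; case: (v \in X).
  by rewrite size_map size_enum_ord mulnC.
move/leq_trans; apply; rewrite addn1 ltnS; apply: leq_mul.
  by apply: leq_trans (size_linear_tree lL uls Els) _; lia.
by rewrite leq_add2r leq_mul2l les orbT.
Qed.

(** * The reduction *)

(** Programs solving, for every oracle in [C], the graphs of cutwidth at least [k]. *)
Definition solver (C : (tree -> option tree) -> Prop) (k : nat) : Prop :=
  exists p F, pbound is_graph F /\ forall O G, C O -> cutwidth_ge G k ->
    exists y t, [/\ exec O p (enc_graph G) y t, t <= F (enc_graph G)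
                  & solution (p := arrangement_problem) G y].

(** On graphs of cutwidth at least [k], an arrangement found within [k] is optimal; a failed search
    raises the lower bound to [k.+1], where the given solver takes over. *)
Lemma solver_pred C k : solver C k.+1 -> solver C k.
Proof.
case=> p [F [bF ep]].
have PS := PTon_cut_search k.
have PH : PTon is_graph (fun g => tfst (trl (cut_search k g))).
  by apply: (@PTon_comp _ (fun=> True) tfst) PS _ => //; apply: PT_fst PT_id.
case: PS => ps [Ts [bTs es]]; case: PH => ph [Th [bTh eh]].
(* The search is run twice, once as the test and once for its result. *)
exists (PIf ps ph p), (fun x => Ts x + (Th x + (F x + 1))); split.
  exact: pbound_add bTs (pbound_add bTh (pbound_add bF (pbound_const _ _))).
move=> O G CO cw; have isG : is_graph (enc_graph G) by exists G.
have [t et let_] := es O _ isG; have [u eu leu] := eh O _ isG.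
case E: (trl (cut_search k (enc_graph G))) et let_ => [|l r] et let_.
  have [|y [v [ev lev soly]]] := ep O G CO.
    move=> phi arr; rewrite ltnNge; apply/negP => le.
    by have := cut_search_complete arr le; rewrite E.
  by exists y, (t + v).+1; split=> //; [apply: ExIfFalse et ev | lia].
have [|phi [arr le Ey]] := @cut_search_found k G; first by rewrite E.
exists (tfst (trl (cut_search k (enc_graph G)))), (t + u).+1; split.
- exact: ExIfTrue et eu.
- by lia.
exists phi => //; split=> // phi' arr'; exact: leq_trans le (cw _ arr').
Qed.

Lemma solver_oracle q c k : solver (fun O => solves_with O q reassembling_problem c k) 3.
Proof.
have : PTon answered (fun x => tfst (trl (mem_search x))).
  by apply: (@PTon_comp _ (fun=> True) tfst) PTon_mem_search _ => //; apply: PT_fst PT_id.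
case=> p [T [[m bT] ep]].
(* Bounds the size of the pair of graph and answer; the 2 is for the node and for the successor in
   the base of [pbound]. *)
pose sz x := tsize x + ((2 * tsize x + 1) * (4 * tsize x + 2) + 1) + 2.
exists (PSeq (PNode PId q) p), (fun x => c * tsize x ^ k + (sz x ^ m + 3)); split.
  pose cst j := pbound_const is_graph j; have bs := pbound_tsize is_graph.
  apply: pbound_add (pbound_mul (cst c) (pbound_exp _ bs)) (pbound_add (pbound_exp _ _) (cst 3)).
  apply: pbound_add (pbound_add bs (pbound_add (pbound_mul _ _) (cst 1))) (cst 2);
    exact: pbound_add (pbound_mul (cst _) bs) (cst _).
move=> O G /(_ G)[y [t [eq let_ soly]]] cw3.
have an : answered (Node (enc_graph G) y) by exists G, y.
have [u eu leu] := ep O _ an.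
exists (tfst (trl (mem_search (Node (enc_graph G) y)))), ((1 + t).+1 + u).+1; split.
- exact: ExSeq (ExNode (ExId _ _) eq) eu.
- have : u <= sz (enc_graph G) ^ m.
    apply: leq_trans (leq_addr _ _) (leq_trans leu (leq_trans (bT _ an) _)).
    case: (m) => // m'; rewrite leq_exp2r // /sz /=.
    by have := tsize_solution soly; lia.
  by rewrite /= in let_; lia.
exact: mem_search_solution.
Qed.

(** Every graph has cutwidth at least 0. The coefficient [2 ^ k] comes from s + 1 ≤ 2s for the input
    size s. *)
Lemma solver_solves C : solver C 0 ->
  exists p c k, forall O, C O -> solves_with O p arrangement_problem c k.
Proof.
case=> p [F [[k bF] ep]]; exists p, (2 ^ k), k => O CO G.
have [|y [t [et let_ soly]]] := ep O G CO; first by move=> phi.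
exists y, t; split=> //; apply: leq_trans let_ (leq_trans (bF _ _) _); first by exists G.
rewrite -expnMn /=; case: (k) => // m; rewrite leq_exp2r // mul2n -addnn -addn1 leq_add2l.
exact: tsize_gt0.
Qed.

(** The three uses of [solver_pred] are the searches for k = 2, 1, 0. The program is chosen before
    [O], which gives the uniformity that reducibility demands. *)
Lemma reduction q c k : exists p c' k', forall O,
  solves_with O q reassembling_problem c k -> solves_with O p arrangement_problem c' k'.
Proof. by apply: solver_solves; do 3! apply: solver_pred; apply: solver_oracle. Qed.

Lemma oracle_solves : exists c k, forall O,
  oracle_for reassembling_problem O -> solves_with O POracle reassembling_problem c k.
Proof.
(* With s the size of the query, the charge is at most 8s² + 9s + 4, and 8 + 9 + 4 = 21. *)
exists 21, 2 => O orc G; have [y Oy soly] := orc G.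
exists y, (tsize (enc_graph G) + tsize y).+1; split=> //; first exact: ExOracle.
have := tsize_solution soly; have := tsize_gt0 (enc_graph G).
by rewrite /= expnS expn1; nia.
Qed.

Theorem theorem4p6 :
  poly_reducible arrangement_problem reassembling_problem /\
  (poly_solvable reassembling_problem -> poly_solvable arrangement_problem).
Proof.
split.
  have [c [k solq]] := oracle_solves.
  have [p [c' [k' red]]] := reduction POracle c k.
  by exists p, c', k' => O /solq/red.
case=> q [c [k solq]]; have [p [c' [k' red]]] := reduction q c k.
by exists p, c', k'; apply: red.
Qed.
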